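(* For every $\overline{e}>0$ there is a constant $c(\overline{e})>0$, depending only on $\overline{e}$, with the following property. Let $U\subset\mathbb{R}\times\mathbb{R}^3$ be a bounded open set and suppose that $$\mathbf{g}\in C(U;\mathbb{R}^3),\quad \mathbb{W}\in C(U;\mathbb{R}^{3\times3}_{{\rm sym},0}),\quad e,r\in C(U),\quad r>0,\quad e\le\overline{e}\ \text{ in }U$$ are given such that $$\frac32\lambda_{\rm max}\left[\frac{\mathbf{g}\otimes\mathbf{g}}{r}-\mathbb{W}\right]<e\quad\text{in }U.$$ Then there exist sequences $$\mathbf{w}_n\in C^\infty_c(U;\mathbb{R}^3),\quad\mathbb{V}_n\in C^\infty_c(U;\mathbb{R}^{3\times3}_{{\rm sym},0}),\quad n=0,1,\dots$$ such that $$\partial_t\mathbf{w}_n+\operatorname{div}_x\mathbb{V}_n=0,\quad\operatorname{div}_x\mathbf{w}_n=0\quad\text{in }\mathbb{R}\times\mathbb{R}^3,$$ $$\frac32\lambda_{\rm max}\left[\frac{(\mathbf{g}+\mathbf{w}_n)\otimes(\mathbf{g}+\mathbf{w}_n)}{r}-(\mathbb{W}+\mathbb{V}_n)\right]<e\quad\text{in }U,$$ and $$\liminf_{n\to\infty}\int_U\frac{|\mathbf{w}_n|^2}{r}\,dx\,dt\ \ge\ c(\overline{e})\int_U\left(e-\frac12\frac{|\mathbf{g}|^2}{r}\right)^2dx\,dt.$$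
   Context: Points of $\mathbb{R}\times\mathbb{R}^3$ are written $(t,x)$. $\mathbb{R}^{3\times3}_{{\rm sym},0}$ is the space of real symmetric traceless $3\times3$ matrices; $\lambda_{\rm max}[\mathbb{A}]$ is the maximal eigenvalue of a symmetric matrix $\mathbb{A}$. Functions in $C^\infty_c(U)$ are extended by zero outside $U$. The functions $\mathbf{g}$, $\mathbb{W}$ are continuous but not necessarily bounded on $U$, and $r$ need not be bounded away from zero on $U$. *)

(* Defs.v *)
From HB Require Import structures.
From mathcomp Require Import all_boot all_order all_algebra.
From mathcomp Require Import all_classical all_reals all_analysis.

Set Implicit Arguments.
Unset Strict Implicit.
Unset Printing Implicit Defensive.

Import Order.TTheory GRing.Theory Num.Theory.
Import numFieldNormedType.Exports.

Local Open Scope classical_set_scope.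
Local Open Scope ring_scope.

(* Points (t, x1, x2, x3) of R x R^3. The iterated product carries both the normed
   module structure (with the max norm) and the product sigma-algebra. *)
Notation spacetime R := (R * R * R * R)%type.

Definition basis_vec (R : realType) (k : 'I_4) : spacetime R :=
  ((k == 0 :> nat)%:R, (k == 1 :> nat)%:R,
   (k == 2 :> nat)%:R, (k == 3 :> nat)%:R).

Definition partial (R : realType) (F : normedModType R) (k : 'I_4)
    (f : spacetime R -> F) : spacetime R -> F :=
  'D_(basis_vec R k) f.

Notation partial_t := (partial ord0).
Notation partial_x i := (partial (lift ord0 (i : 'I_3))).

Definition iter_partial (R : realType) (F : normedModType R)
    (ks : seq 'I_4) (f : spacetime R -> F) : spacetime R -> F :=
  foldr (fun k h => partial k h) f ks.

Definition smooth (R : realType) (F : normedModType R)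
    (f : spacetime R -> F) : Prop :=
  forall ks : seq 'I_4,
    continuous (iter_partial ks f) /\
    forall (k : 'I_4) (p : spacetime R),
      derivable (iter_partial ks f) p (basis_vec R k).

(* Elements of C^oo_c(U) are represented by their extension by zero to the
   whole space-time. *)
Definition smooth_compact_support (R : realType) (F : normedModType R)
    (U : set (spacetime R)) (f : spacetime R -> F) : Prop :=
  let supp := closure [set p | f p != 0] in
  [/\ smooth f, compact supp & supp `<=` U].

Definition div_vec (R : realType) (w : spacetime R -> 'rV[R]_3)
    (p : spacetime R) : R :=
  \sum_(j < 3) partial_x j (fun q => w q 0 j) p.

(* Row-wise divergence: (div_x V)_i = \sum_j d V_ij / d x_j. *)
Definition div_mx (R : realType) (V : spacetime R -> 'M[R]_3)
    (p : spacetime R) : 'rV[R]_3 :=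
  \row_i \sum_(j < 3) partial_x j (fun q => V q i j) p.

Definition sym_traceless (R : realType) (A : 'M[R]_3) : Prop :=
  A^T = A /\ \tr A = 0.

Definition otimes (R : realType) (u v : 'rV[R]_3) : 'M[R]_3 := u^T *m v.

(* The library norm on matrices is the max norm, hence this definition. *)
Definition sqnorm (R : realType) (u : 'rV[R]_3) : R :=
  \sum_(i < 3) u 0 i ^+ 2.

(* For a symmetric A the spectrum is finite and nonempty, so this supremum is
   attained: it is the largest eigenvalue. *)
Definition lambda_max (R : realType) (A : 'M[R]_3) : R :=
  sup [set a | eigenvalue A a].

Definition lebesgue4 (R : realType) :
    {measure set (measurableTypeR R * measurableTypeR R
                  * measurableTypeR R * measurableTypeR R)%type -> \bar R} :=
  (@lebesgue_measure R \x @lebesgue_measure R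
   \x @lebesgue_measure R \x @lebesgue_measure R)%E.

(* Main.v *)
(* The velocity [w] is a superposition of localized stationary plane waves, one
   in each cell of a fine grid.  Freezing the data at a point, let
   [N = 2/3 e I - (g g / r - W)], which is positive definite with trace
   [2 (e - |g|^2 / (2 r))], and let [n] be a unit eigenvector for its largest
   eigenvalue [mu].  The oscillation goes in the direction [h n] with [h^2 / r]
   of order [mu^2 / ebar], and the stress in the direction [h / r (n m + m n)]
   with [m] the part of [g] orthogonal to [n]; a wave of this kind depending on
   [xi . x], with [xi] orthogonal to [n] and [m], solves the equations without
   depending on time.  Third-order potentials turn it into compactly supported
   exact solutions, up to errors which vanish as the frequency tends to
   infinity.  Since [sin^2 + cos^2 = 1], one of the two phases carries half of
   the energy.  A given point lies in an admissible cell of every grid which is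
   fine enough, so that Fatou's lemma yields the lower bound. *)
Require Import Defs.
From HB Require Import structures.
From mathcomp Require Import all_boot all_order all_algebra.
From mathcomp Require Import all_classical all_reals all_analysis.
From mathcomp Require Import measurable_realfun.
From mathcomp Require Import ring lra zify.
Import Order.TTheory GRing.Theory Num.Theory.
Import numFieldNormedType.Exports.
Local Open Scope classical_set_scope.
Local Open Scope ring_scope.

Set Implicit Arguments.
Unset Strict Implicit.
Unset Printing Implicit Defensive.

(** * A flat function *)

(** The square of the gap comes from the cross term. Adding [s h n] to [g] changes [g g / r] by a
    term linear in [s], of size about [h |g| / r], while positivity of the trace of [N] only gives
    [|g|^2 / r < 2 ebar]. The choice of [h^2 / r] of order [mu^2 / ebar] keeps this term below a
    fixed fraction of [mu]. As [N] is positive definite, [mu] lies between 2/3 and 2 times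
    [e - |g|^2 / (2 r)], so the constant involves [ebar] alone. Only the largest eigenvalue of [N]
    is bounded below by the gap; the other two may be arbitrarily small. The part of the cross term
    that is not a multiple of [n n] therefore cannot be absorbed and is cancelled by the stress.
    Nothing is uniform on [U]: the admissible mesh size varies with the point and may degenerate at
    the boundary. Cutoffs and waves are written in a syntactic class of expressions, so that
    identities between differential operators of high order become algebra. *)

Lemma horner_le_expn (R : realType) (P : {poly R}) :
  exists C m, 0 <= C /\ forall y, 1 <= y -> `|P.[y]| <= C * y ^+ m.
Proof.
elim/poly_ind: P => [|P c [C [m [C0 PC]]]].
  by exists 0, 0%N; split => // y _; rewrite horner0 normr0 mul0r.
exists (C + `|c|), m.+1; split => [|y y1]; first by rewrite addr_ge0.
have y0 : 0 <= y by lra.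
rewrite hornerMXaddC (le_trans (ler_normD _ _))// mulrDl lerD//.
  by rewrite normrM (ger0_norm y0) exprSr mulrA ler_wpM2r// PC.
by rewrite ler_peMr// exprn_ege1.
Qed.

(** The exponent -2 is what differentiability at the origin requires: with [y = x^-1] the bound
    reads [C * x ^+ 2], so every derivative of the flat function has derivative zero at 0. *)
Lemma horner_expRN_le (R : realType) (P : {poly R}) :
  exists2 C, 0 <= C &
    forall y, 1 <= y -> `|P.[y] * expR (- y)| <= C * y ^- 2.
Proof.
have [C [m [C0 PC]]] := horner_le_expn P.
exists (C * (m.+2)`!%:R) => [|y y1]; first by rewrite mulr_ge0.
have y0 : 0 < y by lra.
have f0 : 0 < (m.+2)`!%:R :> R by rewrite ltr0n fact_gt0.
rewrite normrM expRN (ger0_norm (_ : 0 <= (expR y)^-1)) ?invr_ge0 ?expR_ge0//.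
have e1 : y ^+ m.+2 / (m.+2)`!%:R <= expR y.
  by rewrite (le_trans _ (expR_ge1Dxn m.+1 (ltW y0)))// lerDr.
rewrite ler_pdivrMr ?expR_gt0// (le_trans (PC _ y1))//.
have -> : C * y ^+ m = C * (m.+2)`!%:R * y ^- 2 * (y ^+ m.+2 / (m.+2)`!%:R).
  rewrite -addn2 exprD; field.
  by rewrite gt_eqF//= gt_eqF.
by rewrite ler_wpM2l// !mulr_ge0// ?invr_ge0 ?exprn_ge0// ltW.
Qed.

Lemma is_derive_quadratic (R : realType) (f : R -> R) (C : R) :
  0 <= C -> f 0 = 0 ->
  (forall h, `|h| <= 1 -> `|f h| <= C * h ^+ 2) -> is_derive (0 : R) (1 : R) f 0.
Proof.
move=> C0 f0 fC.
have cv : (fun h => h^-1 *: ((f \o shift 0) (h *: (1 : R)) - f 0))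
    @ 0^' --> (0 : R).
  apply/cvgrPdist_le => e e0; near=> h.
  rewrite sub0r normrN /= f0 subr0 addr0.
  have hn0 : h != 0 by near: h; exact: nbhs_dnbhs_neq.
  have h1 : `|h| <= 1 by near: h; apply: dnbhs0_le.
  rewrite /GRing.scale /= mulr1 normrM normfV mulrC ler_pdivrMr ?normr_gt0//.
  rewrite (le_trans (fC _ h1))// -normr_id -real_normK ?num_real// expr2 mulrA.
  rewrite normr_id ler_wpM2r//.
  have hle : `|h| <= e / (C + 1) by near: h; apply: dnbhs0_le; rewrite divr_gt0//; lra.
  rewrite (le_trans (ler_wpM2l C0 hle))// mulrCA ler_piMr ?ltW//.
  by rewrite ltr_pdivrMr ?mul1r; lra.
apply: DeriveDef; first by apply/cvg_ex; exists 0.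
exact: cvg_lim cv.
Unshelve. all: by end_near. Qed.

(** For [x > 0], differentiating [P(1/x) exp(-1/x)] gives [x^-2 (P - P')(1/x) exp(-1/x)]; the
    recursion is this rule in the variable [1/x]. *)
Fixpoint flat_poly (R : realType) (n : nat) : {poly R} :=
  if n is m.+1 then 'X^2 * (flat_poly R m - (flat_poly R m)^`()) else 1.

(* The derivatives of the function equal to [exp (- 1 / x)] for [x > 0]. *)
Definition flat (R : realType) (n : nat) (x : R) : R :=
  if 0 < x then (flat_poly R n).[x^-1] * expR (- x^-1) else 0.

Lemma is_derive_flat (R : realType) (n : nat) (x : R) :
  is_derive x 1 (flat n) (flat n.+1 x).
Proof.
have [x0|x0|->] := ltgtP x 0.
- apply: (@near_eq_is_derive _ _ _ (cst 0)).
    near=> y; rewrite /flat /= ltNge ltW//=.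
    by near: y; exact: lt_nbhsl.
  rewrite [flat _ x]/flat ltNge ltW//=; exact: is_derive_cst.
- apply: (@near_eq_is_derive _ _ _
    (((horner (flat_poly R n)) \o (fun x : R => x^-1)) *
     (expR \o (-%R \o (fun x : R => x^-1))))).
    near=> y; rewrite /flat /= ifT//.
    by near: y; exact: lt_nbhsr.
  have xn0 : x != 0 by rewrite gt_eqF.
  have dV : is_derive x 1 (fun x : R => x^-1) (- x ^- 2).
    have := @is_deriveV _ id x 1 1 xn0 (is_derive_id x 1).
    by rewrite /GRing.scale /= mulr1.
  have dN : is_derive x 1 (-%R \o (fun x : R => x^-1)) (x ^- 2).
    have -> : x ^- 2 = - (- x ^- 2) by rewrite opprK.
    exact: is_deriveN.
  have := @is_deriveM _ _ _ _ x 1 _ _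
    (@is_derive1_comp _ (horner (flat_poly R n)) _ x _ _ _ dV)
    (@is_derive1_comp _ expR _ x _ _ _ dN).
  move=> /(_ _ _ (is_derive_poly _ _) (is_derive_expR _)) /is_derive_eq; apply.
  rewrite /flat x0 /= hornerM hornerXn hornerD hornerN exprVn /GRing.scale /=.
  ring.
- rewrite [flat _ 0]/flat ltxx.
  have [C C0 PC] := horner_expRN_le (flat_poly R n).
  apply: (is_derive_quadratic C0); first by rewrite /flat ltxx.
  move=> h h1; rewrite /flat; case: ifPn => h0; last first.
    by rewrite normr0 mulr_ge0// sqr_ge0.
  rewrite (le_trans (PC h^-1 _)) ?exprVn ?invrK//.
  by rewrite invf_ge1// -[h]gtr0_norm.
Unshelve. all: by end_near. Qed.

Lemma flat_ge0 (R : realType) (x : R) : 0 <= flat 0 x.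
Proof.
by rewrite /flat; case: ifP => // _; rewrite hornerC mul1r expR_ge0.
Qed.

Lemma flat_le1 (R : realType) (x : R) : flat 0 x <= 1.
Proof.
rewrite /flat; case: ifP => // x0.
by rewrite hornerC mul1r expR_le1 oppr_le0 invr_ge0 ltW.
Qed.

Lemma flat_eq0 (R : realType) (n : nat) (x : R) : x <= 0 -> flat n x = 0.
Proof. by rewrite /flat ltNge => ->. Qed.

Lemma flat_ge (R : realType) (x : R) : 1 / 2 <= x -> expR (- 2) <= flat 0 x.
Proof.
move=> x2; have x0 : 0 < x by lra.
rewrite /flat x0 hornerC mul1r ler_expR lerN2 invf_ple ?posrE//; lra.
Qed.

(** * An algebra of smooth functions closed under differentiation *)

(** A function of one variable is carried together with all its derivatives, so that differentiating
    a ridge function only raises an index. *)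
Record derivative_chain (R : realType) := DerivativeChain {
  chain :> nat -> R -> R;
  chainP : forall n x, is_derive x (1 : R) (chain n) (chain n.+1 x) }.

Definition dot4 (R : realType) (a p : spacetime R) : R :=
  a.1.1.1 * p.1.1.1 + a.1.1.2 * p.1.1.2 + a.1.2 * p.1.2 + a.2 * p.2.

(** Syntax makes smoothness of every order, symmetry of mixed derivatives and linearity in the
    direction provable by structural induction. Ridge functions [phi (a . p + b)] are enough, since
    both plane waves and tensor-product cutoffs are built from them. *)
Inductive expr (R : realType) : Type :=
| Cst of R
| Add of expr R & expr R
| Scale of R & expr R
| Mul of expr R & expr R
| Ridge of derivative_chain R & nat & spacetime R & R.

Fixpoint eval (R : realType) (e : expr R) (p : spacetime R) : R :=
  match e with
  | Cst c => c
  | Add e1 e2 => eval e1 p + eval e2 p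
  | Scale c e1 => c * eval e1 p
  | Mul e1 e2 => eval e1 p * eval e2 p
  | Ridge phi n a b => phi n (dot4 a p + b)
  end.

Fixpoint dexpr (R : realType) (v : spacetime R) (e : expr R) : expr R :=
  match e with
  | Cst c => Cst 0
  | Add e1 e2 => Add (dexpr v e1) (dexpr v e2)
  | Scale c e1 => Scale c (dexpr v e1)
  | Mul e1 e2 => Add (Mul (dexpr v e1) e2) (Mul e1 (dexpr v e2))
  | Ridge phi n a b => Scale (dot4 a v) (Ridge phi n.+1 a b)
  end.

Lemma dot4D (R : realType) (a p q : spacetime R) :
  dot4 a (p + q) = dot4 a p + dot4 a q.
Proof. by rewrite /dot4 /=; ring. Qed.

Lemma dot4Z (R : realType) (a p : spacetime R) (c : R) :
  dot4 a (c *: p) = c * dot4 a p.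
Proof. by rewrite /dot4 /= /GRing.scale /=; ring. Qed.

Lemma continuous_dot4 (R : realType) (a : spacetime R) : continuous (dot4 a).
Proof.
move=> p; rewrite /dot4.
have cf (A B : topologicalType) : continuous (fst : A * B -> A).
  by move=> x; exact: cvg_fst.
have cs (A B : topologicalType) : continuous (snd : A * B -> B).
  by move=> x; exact: cvg_snd.
have c0 : {for p, continuous (fun q : spacetime R => q.1.1)}.
  by apply: (@continuous_comp _ _ _ fst fst); exact: cf.
have c1 : {for p, continuous (fun q : spacetime R => q.1.1.1)}.
  by apply: (@continuous_comp _ _ _ (fun q : spacetime R => q.1.1) fst p c0); exact: cf.
have c2 : {for p, continuous (fun q : spacetime R => q.1.1.2)}.
  by apply: (@continuous_comp _ _ _ (fun q : spacetime R => q.1.1) snd p c0); exact: cs.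
have c3 : {for p, continuous (fun q : spacetime R => q.1.2)}.
  by apply: (@continuous_comp _ _ _ fst snd); [exact: cf|exact: cs].
have c4 : {for p, continuous (fun q : spacetime R => q.2)} by exact: cs.
apply: cvgD; last by apply: cvgMr.
apply: cvgD; last by apply: cvgMr.
by apply: cvgD; apply: cvgMr.
Qed.

Lemma continuous_eval (R : realType) (e : expr R) : continuous (eval e).
Proof.
elim: e => [c|e1 IH1 e2 IH2|c e1 IH1|e1 IH1 e2 IH2|phi n a b] p /=.
- exact: cvg_cst.
- exact: cvgD (IH1 p) (IH2 p).
- exact: cvgM (@cvg_cst _ _ _ _ _) (IH1 p).
- exact: cvgM (IH1 p) (IH2 p).
- have cphi : {for dot4 a p + b, continuous (phi n)}.
    apply/differentiable_continuous/derivable1_diffP.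
    exact: (@ex_derive _ _ _ _ _ _ _ (chainP phi n _)).
  apply: (@continuous_comp _ _ _ (fun p => dot4 a p + b) (phi n)) => //.
  by apply: cvgD; [exact: continuous_dot4|exact: cvg_cst].
Qed.

(** Restriction to a line turns a directional derivative into a derivative in one real variable,
    where the chain rule for [phi] can be applied. *)
Lemma is_derive_line (R : realType) (V W : normedModType R) (f : V -> W)
    (p v : V) (df : W) :
  is_derive (0 : R) (1 : R) (fun h : R => f (h *: v + p)) df ->
  is_derive p v f df.
Proof.
move=> [d1 d2]; have d3 : derivable f p v by apply/derivable1P.
have d4 : derive f p v = df.
  rewrite -d2 /derive.
  suff -> : (fun h : R => h^-1 *: ((f \o shift p) (h *: v) - f p)) =
    (fun h : R => h^-1 *: (((fun h => f (h *: v + p)) \o shift 0) (h *: (1 : R))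
       - f (0 *: v + p))) by [].
  apply/funext => h /=.
  by rewrite addr0 scale0r add0r [_%:A]mulr1.
exact: DeriveDef d3 d4.
Qed.

Lemma is_derive_eval (R : realType) (e : expr R) (p v : spacetime R) :
  is_derive p v (eval e) (eval (dexpr v e) p).
Proof.
elim: e p v => [c|e1 IH1 e2 IH2|c e1 IH1|e1 IH1 e2 IH2|phi n a b] p v /=.
- exact: is_derive_cst.
- exact: is_deriveD.
- exact: is_deriveZ.
- have := is_deriveM (IH1 p v) (IH2 p v).
  by rewrite /GRing.scale /= addrC (mulrC _ (eval e2 p)).
- apply: is_derive_line.
  have -> : (fun h : R => phi n (dot4 a (h *: v + p) + b)) =
            phi n \o (fun h => dot4 a v * h + (dot4 a p + b)).
    apply/funext => h /=; rewrite dot4D dot4Z; congr (phi n _); ring.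
  have dl : is_derive (0 : R) (1 : R) (fun h => dot4 a v * h + (dot4 a p + b)) (dot4 a v).
    have := is_deriveD (is_deriveZ (dot4 a v) (is_derive_id (0 : R) (1 : R)))
      (is_derive_cst (dot4 a p + b) (0 : R) (1 : R)).
    by rewrite addr0 /GRing.scale /= mulr1.
  have := @is_derive1_comp _ (phi n) _ 0 _ _ (chainP phi n _) dl.
  by rewrite mulr0 add0r mulrC.
Qed.

Lemma dexprC (R : realType) (e : expr R) (u v p : spacetime R) :
  eval (dexpr u (dexpr v e)) p = eval (dexpr v (dexpr u e)) p.
Proof.
elim: e => [c|e1 IH1 e2 IH2|c e1 IH1|e1 IH1 e2 IH2|phi n a b] //=.
- by rewrite IH1 IH2.
- by rewrite IH1.
- by rewrite IH1 IH2; ring.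
- ring.
Qed.

(** [dexpr] acts on syntax but computes the true derivative, hence it respects equality of values.
    This permits rewriting, for instance commuting two derivatives, underneath a further
    derivative. *)
Lemma dexpr_eq (R : realType) (e1 e2 : expr R) (v : spacetime R) :
  eval e1 =1 eval e2 -> eval (dexpr v e1) =1 eval (dexpr v e2).
Proof.
move=> /funext e12 p; case: (is_derive_eval e1 p v) => _ <-.
by case: (is_derive_eval e2 p v) => _ <-; rewrite e12.
Qed.

Lemma dexprD (R : realType) (e : expr R) (u v p : spacetime R) :
  eval (dexpr (u + v) e) p = eval (dexpr u e) p + eval (dexpr v e) p.
Proof.
elim: e => [c|e1 IH1 e2 IH2|c e1 IH1|e1 IH1 e2 IH2|phi n a b] /=.
- by rewrite addr0.
- by rewrite IH1 IH2; ring.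
- by rewrite IH1; ring.
- by rewrite IH1 IH2; ring.
- by rewrite dot4D; ring.
Qed.

Lemma dexprZ (R : realType) (e : expr R) (v p : spacetime R) (c : R) :
  eval (dexpr (c *: v) e) p = c * eval (dexpr v e) p.
Proof.
elim: e => [c'|e1 IH1 e2 IH2|c' e1 IH1|e1 IH1 e2 IH2|phi n a b] /=.
- by rewrite mulr0.
- by rewrite IH1 IH2; ring.
- by rewrite IH1; ring.
- by rewrite IH1 IH2; ring.
- by rewrite dot4Z; ring.
Qed.

Lemma dexpr_eq0 (R : realType) (e : expr R) (v : spacetime R)
    (A : set (spacetime R)) :
  open A -> (forall p, A p -> eval e p = 0) ->
  forall p, A p -> eval (dexpr v e) p = 0.
Proof.
move=> oA e0 p Ap; case: (is_derive_eval e p v) => _ <-.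
have d0 : is_derive p v (eval e) 0.
  apply: (@near_eq_is_derive _ _ _ (cst 0) _ p v 0).
  have := open_nbhs_nbhs (conj oA Ap).
  by apply: filterS => q Aq /=; rewrite e0.
by case: d0.
Qed.

Lemma continuous_mx (R : realType) (T : topologicalType) (m n : nat)
    (F : T -> 'M[R]_(m, n)) (x : T) :
  (forall i j, {for x, continuous (fun t => F t i j)}) ->
  {for x, continuous F}.
Proof.
move=> cF; apply/cvgrPdist_le => /= e e0; near=> t.
rewrite /Num.Def.normr/= mx_normrE (bigmax_le _ (ltW e0))//= => i _.
rewrite !mxE/=; move: i; near: t; apply: filter_forall => /= i.
by move/cvgrPdist_le: (cF i.1 i.2); exact.
Unshelve. all: by end_near. Qed.

Definition eval_mx (R : realType) (m n : nat) (E : 'I_m -> 'I_n -> expr R)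
    (p : spacetime R) : 'M[R]_(m, n) := \matrix_(i, j) eval (E i j) p.

Lemma partial_eval (R : realType) (k : 'I_4) (e : expr R) :
  partial k (eval e) = eval (dexpr (basis_vec R k) e).
Proof.
by apply/funext => p; case: (is_derive_eval e p (basis_vec R k)) => _ <-.
Qed.

Lemma derivable_eval_mx (R : realType) (m n : nat)
    (E : 'I_m -> 'I_n -> expr R) (p v : spacetime R) :
  derivable (eval_mx E) p v.
Proof.
apply/derivable_mxP => i j.
rewrite (_ : (fun x => _) = eval (E i j)).
  by case: (is_derive_eval (E i j) p v).
by apply/funext => q; rewrite mxE.
Qed.

Lemma partial_eval_mx (R : realType) (m n : nat) (k : 'I_4)
    (E : 'I_m -> 'I_n -> expr R) :
  partial k (eval_mx E) =
  eval_mx (fun i j => dexpr (basis_vec R k) (E i j)).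
Proof.
apply/funext => p; rewrite /partial derive_mx; last exact: derivable_eval_mx.
apply/matrixP => i j; rewrite !mxE -partial_eval /partial.
have -> // : (fun q => eval_mx E q i j) = eval (E i j).
by apply/funext => q; rewrite mxE.
Qed.

Lemma smooth_eval_mx (R : realType) (m n : nat)
    (E : 'I_m -> 'I_n -> expr R) : smooth (eval_mx E).
Proof.
move=> ks.
have [E' ->] : exists E', iter_partial ks (eval_mx E) = eval_mx E'.
  elim: ks => [|k ks [E' IH]] /=; first by exists E.
  by rewrite IH partial_eval_mx; eexists.
split => [p|k p]; last exact: derivable_eval_mx.
apply: continuous_mx => i j.
rewrite (_ : (fun x => _) = eval (E' i j)); first exact: continuous_eval.
by apply/funext => q; rewrite mxE.
Qed.

(** * Potentials for the linear system *)

Definition space_vec (R : realType) (v : 'rV[R]_3) : spacetime R :=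
  \sum_(j < 3) v 0 j *: basis_vec R (lift ord0 j).

Lemma dexpr_sum (R : realType) (e : expr R) (I : finType) (c : I -> R)
    (v : I -> spacetime R) (p : spacetime R) :
  eval (dexpr (\sum_i c i *: v i) e) p = \sum_i c i * eval (dexpr (v i) e) p.
Proof.
elim/big_ind2 : _ => [|u1 x1 u2 x2 <- <-|i _]; last by rewrite dexprZ.
  by rewrite -(scale0r (0 : spacetime R)) dexprZ mul0r.
by rewrite dexprD.
Qed.

Lemma eq_sum_dexpr (R : realType) (F : 'I_3 -> expr R) (G : expr R)
    (v : spacetime R) :
  (forall p, \sum_j eval (F j) p = eval G p) ->
  forall p, \sum_j eval (dexpr v (F j)) p = eval (dexpr v G) p.
Proof.
move=> FG p; rewrite -(@dexpr_eq _ (Add (F ord0)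
  (Add (F (lift ord0 ord0)) (F (lift ord0 (lift ord0 ord0)))))) => [|q].
  by rewrite !big_ord_recl big_ord0 /= addr0.
by rewrite -FG !big_ord_recl big_ord0 /= addr0.
Qed.

Section potential.
Variables (R : realType) (n xi m : 'rV[R]_3).

Local Notation D v := (dexpr (space_vec v)).
Local Notation "'E_' j" := (dexpr (basis_vec R (lift ord0 j)))
  (at level 0, j at level 0).
Local Notation Dt := (dexpr (basis_vec R ord0)).

(** The gradient in the plane of [n] and [xi], rotated by a right angle: it is divergence-free by
    symmetry of second derivatives. On a function of [xi . x] it points along [n] if [n] and [xi]
    are orthonormal. *)
Definition Yop (i : 'I_3) (f : expr R) : expr R :=
  Add (Scale (n 0 i) (D xi f)) (Scale (- xi 0 i) (D n f)).

(** The gradient in the plane of [n] and [xi]; its divergence is [Lop], the Laplacian of that plane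
    when the two vectors are orthonormal. *)
Definition Xop (i : 'I_3) (f : expr R) : expr R :=
  Add (Scale (xi 0 i) (D xi f)) (Scale (n 0 i) (D n f)).

Definition Lop (f : expr R) : expr R := Add (D xi (D xi f)) (D n (D n f)).

(** The divergence of [m Lop f] is [D m (Lop f)], which is also that of [D m (Xop f)]; the
    difference is divergence-free and keeps the leading direction [m] on waves in [xi . x] when [m]
    is orthogonal to [xi]. *)
Definition Zop (i : 'I_3) (f : expr R) : expr R :=
  Add (Scale (m 0 i) (Lop f)) (Scale (-1) (D m (Xop i f))).

Lemma div_Yop (f : expr R) (p : spacetime R) :
  \sum_j eval (E_ j (Yop j f)) p = 0.
Proof.
rewrite /= big_split /=.
under [X in _ + X]eq_bigr do rewrite mulNr.
by rewrite sumrN -!dexpr_sum -/(space_vec _) dexprC subrr.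
Qed.

Lemma div_Xop (f : expr R) (p : spacetime R) :
  \sum_j eval (E_ j (Xop j f)) p = eval (Lop f) p.
Proof. by rewrite /= big_split /= -!dexpr_sum. Qed.

Lemma div_Zop (f : expr R) (p : spacetime R) :
  \sum_j eval (E_ j (Zop j f)) p = 0.
Proof.
rewrite [LHS](eq_bigr (fun j => m 0 j * eval (E_ j (Lop f)) p -
    eval (D m (E_ j (Xop j f))) p)); last first.
  by move=> j _; rewrite -dexprC /= mulN1r.
by rewrite sumrB -dexpr_sum (eq_sum_dexpr _ (div_Xop f)) subrr.
Qed.

Lemma div_Yop_comm (F : 'I_3 -> expr R) (G : expr R) (i : 'I_3) :
  (forall p, \sum_j eval (E_ j (F j)) p = eval G p) ->
  forall p, \sum_j eval (E_ j (Yop i (F j))) p = eval (Yop i G) p.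
Proof.
move=> FG p; rewrite /= big_split /= -!mulr_sumr.
under eq_bigr do rewrite dexprC.
under [X in _ + _ * X]eq_bigr do rewrite dexprC.
by rewrite !(eq_sum_dexpr _ FG).
Qed.

Definition velocity (h : R) (psi : expr R) (i : 'I_3) : expr R :=
  Scale h (Yop i (Lop psi)).

(** The first summand is a symmetrized product of two divergence-free operators, so its rows have
    zero divergence. The second has divergence [- h Dt (Yop i (Lop psi))] and balances the time
    derivative of the velocity; for a stationary wave that derivative comes from the cutoff only. *)
Definition stress (h c : R) (psi : expr R) (i j : 'I_3) : expr R :=
  Add (Scale c (Add (Yop i (Zop j psi)) (Yop j (Zop i psi))))
      (Scale (- h) (Dt (Add (Yop i (Xop j psi)) (Yop j (Xop i psi))))).

Lemma div_velocity (h : R) (psi : expr R) (p : spacetime R) :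
  \sum_j eval (E_ j (velocity h psi j)) p = 0.
Proof.
rewrite (eq_bigr (fun j => h * eval (E_ j (Yop j (Lop psi))) p)) //.
by rewrite -mulr_sumr div_Yop mulr0.
Qed.

Lemma stressC (h c : R) (psi : expr R) (i j : 'I_3) (p : spacetime R) :
  eval (stress h c psi i j) p = eval (stress h c psi j i) p.
Proof.
by rewrite [LHS]/= [RHS]/=; congr (_ * _ + _ * _); rewrite addrC.
Qed.

Lemma div_stress (h c : R) (psi : expr R) (i : 'I_3) (p : spacetime R) :
  eval (Dt (velocity h psi i)) p +
  \sum_j eval (E_ j (stress h c psi i j)) p = 0.
Proof.
have Z0 q : \sum_j eval (E_ j (Yop i (Zop j psi))) q = 0.
  rewrite (@div_Yop_comm _ (Cst 0)) => [|q']; last by rewrite div_Zop.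
  by rewrite /= !mulr0 addr0.
have X0 q : \sum_j eval (Dt (E_ j (Yop i (Xop j psi)))) q =
    eval (Dt (Yop i (Lop psi))) q.
  by rewrite (eq_sum_dexpr _ (div_Yop_comm i (div_Xop psi))).
have Y0 q : \sum_j eval (Dt (E_ j (Yop j (Xop i psi)))) q = 0.
  by rewrite (@eq_sum_dexpr _ _ (Cst 0)) => [//|q']; rewrite div_Yop.
rewrite [X in _ + X](eq_bigr (fun j =>
  c * (eval (E_ j (Yop i (Zop j psi))) p +
       eval (E_ j (Yop j (Zop i psi))) p) +
  (- h) * (eval (Dt (E_ j (Yop i (Xop j psi)))) p +
           eval (Dt (E_ j (Yop j (Xop i psi)))) p))); last first.
  by move=> j _; rewrite -2!(dexprC _ (basis_vec R (lift ord0 j))).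
have sumD (F G : 'I_3 -> R) : \sum_i (F i + G i) = \sum_i F i + \sum_i G i.
  exact: big_split.
rewrite sumD -!mulr_sumr (sumD (fun j => eval (E_ j (Yop i (Zop j psi))) p)).
rewrite (sumD (fun j => eval (Dt (E_ j (Yop i (Xop j psi)))) p)) Z0 X0 Y0 div_Yop !addr0 mulr0 add0r.
have -> : eval (Dt (velocity h psi i)) p = h * eval (Dt (Yop i (Lop psi))) p by [].
by rewrite mulNr subrr.
Qed.

Hypotheses (nn : \sum_i n 0 i * n 0 i = 1) (xx : \sum_i xi 0 i * xi 0 i = 1).
Hypotheses (nx : \sum_i n 0 i * xi 0 i = 0).
Hypotheses (mn : \sum_i m 0 i * n 0 i = 0) (mx : \sum_i m 0 i * xi 0 i = 0).

Lemma trace_Yop_Xop (v : spacetime R) (f : expr R) (p : spacetime R) :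
  \sum_i eval (dexpr v (Yop i (Xop i f))) p = 0.
Proof.
have xn : \sum_i xi 0 i * n 0 i = 0 by under eq_bigr do rewrite mulrC.
pose E u w := eval (dexpr v (D u (D w f))) p.
rewrite (eq_bigr (fun i => (n 0 i * xi 0 i * E xi xi + n 0 i * n 0 i * E xi n) -
    (xi 0 i * xi 0 i * E n xi + xi 0 i * n 0 i * E n n))); last first.
  by move=> i _; rewrite /E /=; ring.
rewrite big_split /= sumrN !big_split /= -!mulr_suml nn xx nx xn !mul0r !mul1r.
rewrite addr0 add0r /E (@dexpr_eq _ (D xi (D n f)) (D n (D xi f))) ?subrr//.
by move=> q; rewrite dexprC.
Qed.

(** Orthogonality of [m] to [n] and [xi] removes the terms in [Lop f], and orthonormality of [n] and
    [xi] reduces the rest to a commutator of [D xi] and [D n] around [D m]. *)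
Lemma trace_Yop_Zop (f : expr R) (p : spacetime R) :
  \sum_i eval (Yop i (Zop i f)) p = 0.
Proof.
have xn : \sum_i xi 0 i * n 0 i = 0 by under eq_bigr do rewrite mulrC.
have nm : \sum_i n 0 i * m 0 i = 0 by under eq_bigr do rewrite mulrC.
have xm : \sum_i xi 0 i * m 0 i = 0 by under eq_bigr do rewrite mulrC.
pose E u w := eval (D u (D m (D w f))) p.
pose F u := eval (D u (Lop f)) p.
rewrite (eq_bigr (fun i => (n 0 i * m 0 i * F xi -
      (n 0 i * xi 0 i * E xi xi + n 0 i * n 0 i * E xi n)) -
    (xi 0 i * m 0 i * F n -
      (xi 0 i * xi 0 i * E n xi + xi 0 i * n 0 i * E n n)))); last first.
  by move=> i _; rewrite /E /F /=; ring.
rewrite !(big_split, sumrN) /= -!mulr_suml nn xx nx xn nm xm !mul0r !mul1r.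
rewrite addr0 !add0r opprK addrC /E.
rewrite (@dexpr_eq _ (D m (D xi f)) (D xi (D m f))); last by move=> q; rewrite dexprC.
rewrite (@dexpr_eq _ (D m (D n f)) (D n (D m f))); last by move=> q; rewrite dexprC.
by rewrite dexprC subrr.
Qed.

Lemma trace_stress (h c : R) (psi : expr R) (p : spacetime R) :
  \sum_i eval (stress h c psi i i) p = 0.
Proof.
rewrite (eq_bigr (fun i => c * (eval (Yop i (Zop i psi)) p * 2) +
    - h * (eval (Dt (Yop i (Xop i psi))) p * 2))); last first.
  move=> i _; pose a := eval (Yop i (Zop i psi)) p.
  pose b := eval (Dt (Yop i (Xop i psi))) p.
  rewrite -/a -/b [LHS](_ : _ = c * (a + a) + - h * (b + b)) //; ring.
rewrite big_split /= -!mulr_sumr -!mulr_suml trace_Yop_Xop trace_Yop_Zop.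
by rewrite !mul0r !mulr0 addr0.
Qed.

End potential.

(** * Localized plane waves *)

Lemma is_derive_trig (R : realType) (a : R) (n : nat) (x : R) :
  is_derive x (1 : R) (fun y => sin (y + (a + n%:R * (pi / 2))))
    (sin (x + (a + n.+1%:R * (pi / 2)))).
Proof.
have := @is_derive1_comp R sin (shift (a + n%:R * (pi / 2))) x _ _
  (is_derive_sin _) (is_derive_shift _ _ _).
rewrite mulr1 /= -sinDpihalf => /is_derive_eq; apply.
by rewrite -natr1; congr sin; ring.
Qed.

Definition trig (R : realType) (a : R) : derivative_chain R :=
  DerivativeChain (is_derive_trig a).

Definition flat_chain (R : realType) : derivative_chain R :=
  DerivativeChain (@is_derive_flat R).

Definition vanishes_off (R : realType) (K : set (spacetime R)) (f : expr R) :=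
  forall p, ~ K p -> eval f p = 0.

Lemma vanishes_off_dexpr (R : realType) (K : set (spacetime R)) (f : expr R)
    (v : spacetime R) :
  closed K -> vanishes_off K f -> vanishes_off K (dexpr v f).
Proof. by move=> /closed_openC oK f0; exact: dexpr_eq0 oK f0. Qed.

Lemma vanishes_off_bounded (R : realType) (K : set (spacetime R)) (f : expr R) :
  compact K -> vanishes_off K f ->
  exists2 B, 0 <= B & forall p, `|eval f p| <= B.
Proof.
move=> cK f0; have cf : {within K, continuous (eval f)}.
  by apply/continuous_subspaceT/continuous_eval.
have [M [_ MB]] := compact_bounded (continuous_compact cf cK).
exists (`|M| + 1) => [|p]; first by rewrite addr_ge0.
have [Kp|/f0 ->] := pselect (K p); last by rewrite normr0 addr_ge0.
by apply: (MB (`|M| + 1)); [rewrite ltr_pwDr// ler_norm|exists p].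
Qed.

Definition unif_close (R : realType) (T : Type) (f g : R -> T -> R) :=
  forall eps, 0 < eps ->
    \forall k \near +oo, forall p, `|f k p - g k p| <= eps.

Lemma unif_closeD (R : realType) (T : Type) (f1 g1 f2 g2 : R -> T -> R) :
  unif_close f1 g1 -> unif_close f2 g2 ->
  unif_close (fun k p => f1 k p + f2 k p) (fun k p => g1 k p + g2 k p).
Proof.
move=> fg1 fg2 eps eps0; have e2 : 0 < eps / 2 by lra.
near=> k => p; rewrite opprD addrACA (le_trans (ler_normD _ _))// (splitr eps).
by rewrite lerD//; move: p; near: k; [exact: fg1|exact: fg2].
Unshelve. all: by end_near. Qed.

Lemma unif_closeZ (R : realType) (T : Type) (f g : R -> T -> R) (c : R) :
  unif_close f g ->
  unif_close (fun k p => c * f k p) (fun k p => c * g k p).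
Proof.
move=> fg eps eps0; have c0 : 0 < `|c| + 1 by rewrite ltr_wpDl.
near=> k => p; rewrite -mulrBr normrM.
have : `|f k p - g k p| <= eps / (`|c| + 1).
  by move: p; near: k; apply: fg; rewrite divr_gt0.
rewrite ler_pdivlMr// => /(le_trans _); apply.
by rewrite mulrC ler_wpM2l// lerDl.
Unshelve. all: by end_near. Qed.

(** The fields use derivatives of order three in space, or one in time and two in space; the factor
    [k ^- 3] normalizes the term where all three fall on the wave. *)
Definition plane_wave (R : realType) (phi : derivative_chain R)
    (chi : expr R) (xi : spacetime R) (k : R) : expr R :=
  Scale (k ^- 3) (Mul chi (Ridge phi 0 (k *: xi) 0)).

Lemma unif_close_plane_wave (R : realType) (phi : derivative_chain R)
    (chi : expr R) (xi : spacetime R) (K : set (spacetime R))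
    (a b c : spacetime R) :
  (forall n x, `|phi n x| <= 1) -> compact K -> closed K ->
  vanishes_off K chi ->
  unif_close
    (fun k => eval (dexpr a (dexpr b (dexpr c (plane_wave phi chi xi k)))))
    (fun k p => dot4 xi a * dot4 xi b * dot4 xi c *
       (eval chi p * phi 3%N (dot4 (k *: xi) p + 0))).
Proof.
move=> phi1 cK clK chi0 eps eps0.
have V1 v : vanishes_off K (dexpr v chi) by exact: vanishes_off_dexpr.
have V2 u v : vanishes_off K (dexpr u (dexpr v chi)).
  exact: vanishes_off_dexpr.
have V3 : vanishes_off K (dexpr a (dexpr b (dexpr c chi))).
  exact: vanishes_off_dexpr.
have [B0 B00 hB0] := vanishes_off_bounded cK V3.
(* Leibniz terms with exactly one ([A1]) or two ([A2]) derivatives on the ridge. They carry [k ^- 2]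
   and [k ^- 1], and their coefficients are bounded because the cutoff has compact support. Nested
   in powers of [k^-1 <= 1], the total error is at most [(B2 + B1 + B0) / k]. *)
pose A1 := Add (Scale (dot4 xi a) (dexpr b (dexpr c chi)))
  (Add (Scale (dot4 xi b) (dexpr a (dexpr c chi)))
       (Scale (dot4 xi c) (dexpr a (dexpr b chi)))).
pose A2 := Add (Scale (dot4 xi a * dot4 xi b) (dexpr c chi))
  (Add (Scale (dot4 xi a * dot4 xi c) (dexpr b chi))
       (Scale (dot4 xi b * dot4 xi c) (dexpr a chi))).
have [B1 B10 hB1] : exists2 B, 0 <= B & forall p, `|eval A1 p| <= B.
  by apply: vanishes_off_bounded cK _ => p Kp /=; rewrite !V2// !mulr0 !addr0.
have [B2 B20 hB2] : exists2 B, 0 <= B & forall p, `|eval A2 p| <= B.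
  by apply: vanishes_off_bounded cK _ => p Kp /=; rewrite !V1// !mulr0 !addr0.
near=> k => p.
have k1 : 1 <= k by near: k; exact: nbhs_pinfty_ge.
have kB : (B0 + B1 + B2) / eps <= k.
  by near: k; apply: nbhs_pinfty_ge; rewrite num_real.
have k0 : 0 < k by lra.
have dZ v : dot4 (k *: xi) v = k * dot4 xi v.
  by rewrite /dot4 /= /GRing.scale /=; ring.
pose u := dot4 (k *: xi) p + 0.
rewrite [X in `|X|](_ : _ = k^-1 * (eval A2 p * phi 2%N u +
    k^-1 * (eval A1 p * phi 1%N u +
    k^-1 * (eval (dexpr a (dexpr b (dexpr c chi))) p * phi 0%N u)))); last first.
  rewrite /= -/u !dZ.
  move: (eval _ p) (eval _ p) (eval _ p) (eval _ p) (eval _ p) (eval _ p)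
    (eval _ p) (eval _ p) (phi _ u) (phi _ u) (phi _ u) (phi _ u)
    (dot4 _ _) (dot4 _ _) (dot4 _ _) => *.
  by field; rewrite gt_eqF.
have bnd x B n : `|x| <= B -> `|x * phi n u| <= B.
  by move=> xB; rewrite normrM (le_trans _ xB)// ler_piMr.
have ki1 : k^-1 <= 1 by rewrite invf_le1.
have shrink x B : `|x| <= B -> `|k^-1 * x| <= B.
  move=> xB; rewrite normrM normfV (gtr0_norm k0) (le_trans _ xB)//.
  by rewrite ler_piMl.
rewrite normrM normfV (gtr0_norm k0) mulrC ler_pdivrMr//.
move: kB; rewrite ler_pdivrMr// mulrC; apply: le_trans.
rewrite (_ : B0 + B1 + B2 = B2 + (B1 + B0)); last by ring.
rewrite (le_trans (ler_normD _ _))// lerD ?bnd// shrink//.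
rewrite (le_trans (ler_normD _ _))// lerD ?bnd// shrink//.
exact: bnd.
Unshelve. all: by end_near. Qed.

Lemma unif_close_eq (R : realType) (T : Type) (f f' g g' : R -> T -> R) :
  (forall k p, f k p = f' k p) -> (forall k p, g k p = g' k p) ->
  unif_close f' g' -> unif_close f g.
Proof.
move=> ff' gg' fg eps eps0; apply: filterS (fg _ eps0) => k fgk p.
by rewrite ff' gg'.
Qed.

Lemma dot4_space_vec (R : realType) (u v : 'rV[R]_3) :
  dot4 (space_vec u) (space_vec v) = \sum_j u 0 j * v 0 j.
Proof.
rewrite /dot4 /space_vec !big_ord_recl !big_ord0 /= /GRing.scale /=; ring.
Qed.

Lemma dot4_space_time (R : realType) (u : 'rV[R]_3) :
  dot4 (space_vec u) (basis_vec R ord0) = 0.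
Proof.
rewrite /dot4 /space_vec !big_ord_recl !big_ord0 /= /GRing.scale /=; ring.
Qed.

Section wave_asymptotics.
Variables (R : realType) (phi : derivative_chain R) (chi : expr R).
Variables (K : set (spacetime R)) (n xi m : 'rV[R]_3).
Hypotheses (phi1 : forall l x, `|phi l x| <= 1).
Hypotheses (cK : compact K) (clK : closed K) (chiK : vanishes_off K chi).
Hypotheses (xx : \sum_i xi 0 i * xi 0 i = 1) (nx : \sum_i n 0 i * xi 0 i = 0).
Hypotheses (mx : \sum_i m 0 i * xi 0 i = 0).

Let psi k := plane_wave phi chi (space_vec xi) k.
Let s k p := eval chi p * phi 3%N (dot4 (k *: space_vec xi) p + 0).
Let T a b c := unif_close_plane_wave (space_vec xi) a b c phi1 cK clK chiK.
Let d (v : 'rV[R]_3) := space_vec v.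

Let dxx : dot4 (space_vec xi) (space_vec xi) = 1.
Proof. by rewrite dot4_space_vec. Qed.

Let dxn : dot4 (space_vec xi) (space_vec n) = 0.
Proof. by rewrite dot4_space_vec -[RHS]nx; apply: eq_bigr => i _; rewrite mulrC. Qed.

Let dxm : dot4 (space_vec xi) (space_vec m) = 0.
Proof. by rewrite dot4_space_vec -[RHS]mx; apply: eq_bigr => i _; rewrite mulrC. Qed.

Lemma unif_close_velocity (h : R) (i : 'I_3) :
  unif_close (fun k => eval (velocity n xi h (psi k) i))
    (fun k p => s k p * (h * n 0 i)).
Proof.
(* The combination repeats the expression tree of [velocity], so its left-hand side agrees by
   computation; in the limit [D xi] becomes the factor 1 and [D n] the factor 0. *)
apply: unif_close_eq; last exact: (unif_closeZ h (unif_closeD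
  (unif_closeZ (n 0 i) (unif_closeD (T (d xi) (d xi) (d xi)) (T (d xi) (d n) (d n))))
  (unif_closeZ (- xi 0 i) (unif_closeD (T (d n) (d xi) (d xi)) (T (d n) (d n) (d n)))))).
  by [].
by move=> k p; rewrite /d dxx dxn /s; ring.
Qed.

Let unif_close_YZ (i j : 'I_3) :
  unif_close (fun k => eval (Yop n xi i (Zop n xi m j (psi k))))
    (fun k p => s k p * (n 0 i * m 0 j)).
Proof.
have Z v : unif_close (fun k => eval (dexpr (d v) (Zop n xi m j (psi k))))
    (fun k p => s k p * (dot4 (d xi) (d v) * m 0 j)).
  apply: unif_close_eq; last exact: (unif_closeD
    (unif_closeZ (m 0 j) (unif_closeD (T (d v) (d xi) (d xi)) (T (d v) (d n) (d n))))
    (unif_closeZ (-1) (unif_closeD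
      (unif_closeZ (xi 0 j) (T (d v) (d m) (d xi)))
      (unif_closeZ (n 0 j) (T (d v) (d m) (d n)))))).
    by [].
  by move=> k p; rewrite /d dxx dxn dxm /s; ring.
apply: unif_close_eq; last exact: (unif_closeD
  (unif_closeZ (n 0 i) (Z xi)) (unif_closeZ (- xi 0 i) (Z n))).
  by [].
by move=> k p; rewrite /d dxx dxn; ring.
Qed.

Let unif_close_tYX (i j : 'I_3) :
  unif_close (fun k => eval (dexpr (basis_vec R ord0)
      (Yop n xi i (Xop n xi j (psi k)))))
    (fun k p => 0).
Proof.
pose t := basis_vec R ord0.
have X v : unif_close (fun k => eval (dexpr t (dexpr (d v) (Xop n xi j (psi k)))))
    (fun k p => 0).
  apply: unif_close_eq; last exact: (unif_closeD
    (unif_closeZ (xi 0 j) (T t (d v) (d xi)))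
    (unif_closeZ (n 0 j) (T t (d v) (d n)))).
    by [].
  by move=> k p; rewrite /t dot4_space_time; ring.
apply: unif_close_eq; last exact: (unif_closeD
  (unif_closeZ (n 0 i) (X xi)) (unif_closeZ (- xi 0 i) (X n))).
  by [].
by move=> k p /=; ring.
Qed.

Lemma unif_close_stress (h c : R) (i j : 'I_3) :
  unif_close (fun k => eval (stress n xi m h c (psi k) i j))
    (fun k p => s k p * (c * (n 0 i * m 0 j + n 0 j * m 0 i))).
Proof.
apply: unif_close_eq; last exact: (unif_closeD
  (unif_closeZ c (unif_closeD (unif_close_YZ i j) (unif_close_YZ j i)))
  (unif_closeZ (- h) (unif_closeD (unif_close_tYX i j) (unif_close_tYX j i)))).
  by [].
by move=> k p /=; ring.
Qed.

End wave_asymptotics.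

(** * Closed boxes and bump functions *)

Definition box (R : realType) (c : spacetime R) (rho : R) : set (spacetime R) :=
  `[c.1.1.1 - rho, c.1.1.1 + rho] `*` `[c.1.1.2 - rho, c.1.1.2 + rho] `*`
  `[c.1.2 - rho, c.1.2 + rho] `*` `[c.2 - rho, c.2 + rho].

Lemma boxP (R : realType) (c : spacetime R) (rho : R) (p : spacetime R) :
  box c rho p <-> forall k, `|dot4 (basis_vec R k) (p - c)| <= rho.
Proof.
have E1 : dot4 (basis_vec R ord0) (p - c) = p.1.1.1 - c.1.1.1.
  by rewrite /dot4 /=; ring.
have E2 : dot4 (basis_vec R (lift ord0 ord0)) (p - c) = p.1.1.2 - c.1.1.2.
  by rewrite /dot4 /=; ring.
have E3 : dot4 (basis_vec R (lift ord0 (lift ord0 ord0))) (p - c) = p.1.2 - c.1.2.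
  by rewrite /dot4 /=; ring.
have E4 : dot4 (basis_vec R (lift ord0 (lift ord0 (lift ord0 ord0)))) (p - c) =
    p.2 - c.2.
  by rewrite /dot4 /=; ring.
have I (x y : R) : x \in `[y - rho, y + rho] <-> `|x - y| <= rho.
  by rewrite in_itv /= ler_distl; split => /andP[? ?]; apply/andP; split; lra.
rewrite /box /=; split => [[[[/I h1 /I h2] /I h3] /I h4] k|hk]; last first.
  split; [split; [split|]|]; apply/I.
  - by rewrite -E1.
  - by rewrite -E2.
  - by rewrite -E3.
  - by rewrite -E4.
case: (unliftP ord0 k) => [k' ->|->]; last by rewrite E1.
case: (unliftP ord0 k') => [k'' ->|->]; last by rewrite E2.
case: (unliftP ord0 k'') => [k3 ->|->]; last by rewrite E3.
by rewrite (ord1 k3) E4.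
Qed.

Lemma compact_box (R : realType) (c : spacetime R) (rho : R) :
  compact (box c rho).
Proof. by do !apply: compact_setX; exact: segment_compact. Qed.

Lemma closed_box (R : realType) (c : spacetime R) (rho : R) :
  closed (box c rho).
Proof. by apply: compact_closed => //; exact: compact_box. Qed.

Section bump.
Variables (R : realType) (c : spacetime R) (rho : R).
Hypothesis rho0 : 0 < rho.

Definition bump1 (k : 'I_4) : expr R :=
  let a := rho^-1 *: basis_vec R k in
  Mul (Ridge (flat_chain R) 0 (- a) (1 + dot4 a c))
      (Ridge (flat_chain R) 0 a (1 - dot4 a c)).

Definition bump : expr R :=
  Mul (Mul (bump1 ord0) (bump1 (lift ord0 ord0)))
      (Mul (bump1 (lift ord0 (lift ord0 ord0)))
           (bump1 (lift ord0 (lift ord0 (lift ord0 ord0))))).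

Lemma eval_bump1 (k : 'I_4) (p : spacetime R) :
  let u := dot4 (basis_vec R k) (p - c) / rho in
  eval (bump1 k) p = flat 0 (1 - u) * flat 0 (1 + u).
Proof.
move=> u; rewrite /bump1; cbn [eval chain flat_chain].
by congr (flat _ _ * flat _ _); rewrite /u /dot4 /= /GRing.scale /=; ring.
Qed.

Lemma bump1_ge0 (k : 'I_4) (p : spacetime R) : 0 <= eval (bump1 k) p.
Proof. by rewrite eval_bump1 mulr_ge0 ?flat_ge0. Qed.

Lemma bump1_le1 (k : 'I_4) (p : spacetime R) : eval (bump1 k) p <= 1.
Proof. by rewrite eval_bump1; apply: mulr_ile1; rewrite ?flat_ge0 ?flat_le1. Qed.

Lemma bump1_eq0 (k : 'I_4) (p : spacetime R) :
  rho < `|dot4 (basis_vec R k) (p - c)| -> eval (bump1 k) p = 0.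
Proof.
rewrite eval_bump1; set x := dot4 _ _ => /ltW; rewrite ler_normr => /orP[] xr.
  rewrite (@flat_eq0 _ _ (1 - _)) ?mul0r// subr_le0 ler_pdivlMr//; lra.
rewrite (@flat_eq0 _ _ (1 + _)) ?mulr0//.
by rewrite -[x]opprK mulNr subr_le0 ler_pdivlMr//; lra.
Qed.

Lemma bump1_ge (k : 'I_4) (p : spacetime R) :
  `|dot4 (basis_vec R k) (p - c)| <= rho / 2 -> expR (- 4) <= eval (bump1 k) p.
Proof.
rewrite eval_bump1; set x := dot4 _ _; rewrite ler_norml => /andP[x1 x2].
have -> : - 4 = - 2 + - 2 :> R by lra.
have y1 : - (1 / 2) <= x / rho by rewrite ler_pdivlMr//; lra.
have y2 : x / rho <= 1 / 2 by rewrite ler_pdivrMr//; lra.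
by rewrite expRD ler_pM ?expR_ge0 ?flat_ge//; lra.
Qed.

Lemma eval_bump (p : spacetime R) :
  eval bump p = (eval (bump1 ord0) p * eval (bump1 (lift ord0 ord0)) p) *
    (eval (bump1 (lift ord0 (lift ord0 ord0))) p *
     eval (bump1 (lift ord0 (lift ord0 (lift ord0 ord0)))) p).
Proof. by []. Qed.

Lemma bump_ge0 (p : spacetime R) : 0 <= eval bump p.
Proof. by rewrite eval_bump; apply: mulr_ge0; apply: mulr_ge0; exact: bump1_ge0. Qed.

Lemma bump_le1 (p : spacetime R) : eval bump p <= 1.
Proof.
rewrite eval_bump.
have b12 k l : 0 <= eval (bump1 k) p * eval (bump1 l) p <= 1.
  apply/andP; split; first by apply: mulr_ge0; exact: bump1_ge0.
  by apply: mulr_ile1; rewrite ?bump1_ge0 ?bump1_le1.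
have /andP[? ?] := b12 ord0 (lift ord0 ord0).
have /andP[? ?] := b12 (lift ord0 (lift ord0 ord0)) (lift ord0 (lift ord0 (lift ord0 ord0))).
exact: mulr_ile1.
Qed.

Lemma bump_vanishes_off : vanishes_off (box c rho) bump.
Proof.
move=> p; rewrite boxP => /existsNP[k /negP]; rewrite -ltNge => /bump1_eq0 k0.
rewrite eval_bump; move: k0.
case: (unliftP ord0 k) => [k' ->|-> ->]; last by rewrite !mul0r.
case: (unliftP ord0 k') => [k'' ->|-> ->]; last by rewrite !(mul0r, mulr0).
case: (unliftP ord0 k'') => [k3 ->|-> ->]; last by rewrite !(mul0r, mulr0).
by rewrite (ord1 k3) => ->; rewrite !mulr0.
Qed.

(** On the half-size box each of the eight flat factors has argument at least 1/2, hence value at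
    least [exp(-2)]. This is the source of [expR (- 16)] in the energy constant. *)
Lemma bump_ge (p : spacetime R) :
  box c (rho / 2) p -> expR (- 16) <= eval bump p.
Proof.
rewrite boxP => pc; rewrite eval_bump.
have -> : - 16 = (- 4 + - 4) + (- 4 + - 4) :> R by lra.
rewrite !expRD; apply: ler_pM; rewrite ?mulr_ge0 ?expR_ge0//;
  by apply: ler_pM; rewrite ?expR_ge0// bump1_ge.
Qed.

End bump.

(** * Quadratic forms and the largest eigenvalue *)

Definition form (R : realType) (A : 'M[R]_3) (u v : 'rV[R]_3) : R :=
  \sum_i \sum_j u 0 i * A i j * v 0 j.

Definition dot (R : realType) (u v : 'rV[R]_3) : R := \sum_i u 0 i * v 0 i.

Lemma sum3E (R : realType) (F : 'I_3 -> R) :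
  \sum_i F i = F 0 + F 1 + F 2%:R.
Proof.
rewrite !big_ord_recr big_ord0 /= add0r.
by congr (F _ + F _ + F _); apply/val_inj.
Qed.

Lemma dotC (R : realType) (u v : 'rV[R]_3) : dot u v = dot v u.
Proof. by apply: eq_bigr => i _; rewrite mulrC. Qed.

Lemma dotDl (R : realType) (u u' v : 'rV[R]_3) :
  dot (u + u') v = dot u v + dot u' v.
Proof. by rewrite /dot !sum3E !mxE; ring. Qed.

Lemma dotZl (R : realType) (c : R) (u v : 'rV[R]_3) :
  dot (c *: u) v = c * dot u v.
Proof. by rewrite /dot !sum3E !mxE; ring. Qed.

Lemma dotDr (R : realType) (u u' v : 'rV[R]_3) :
  dot v (u + u') = dot v u + dot v u'.
Proof. by rewrite !(dotC v) dotDl. Qed.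

Lemma dotZr (R : realType) (c : R) (u v : 'rV[R]_3) :
  dot v (c *: u) = c * dot v u.
Proof. by rewrite !(dotC v) dotZl. Qed.

Lemma dot_ge0 (R : realType) (u : 'rV[R]_3) : 0 <= dot u u.
Proof. by apply: sumr_ge0 => i _; rewrite -expr2 sqr_ge0. Qed.

Lemma dot_eq0 (R : realType) (u : 'rV[R]_3) : dot u u = 0 -> u = 0.
Proof.
move=> u0; apply/rowP => i; rewrite mxE; apply/eqP.
rewrite -sqrf_eq0 expr2; apply/eqP; move: i (erefl true).
by apply: psumr_eq0P u0 => i _; rewrite -expr2 sqr_ge0.
Qed.

Lemma formDl (R : realType) (A : 'M[R]_3) (u u' v : 'rV[R]_3) :
  form A (u + u') v = form A u v + form A u' v.
Proof.
rewrite /form -big_split; apply: eq_bigr => i _ /=; rewrite -big_split.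
by apply: eq_bigr => j _; rewrite mxE !mulrDl.
Qed.

Lemma formZl (R : realType) (A : 'M[R]_3) (c : R) (u v : 'rV[R]_3) :
  form A (c *: u) v = c * form A u v.
Proof.
rewrite /form mulr_sumr; apply: eq_bigr => i _; rewrite mulr_sumr.
by apply: eq_bigr => j _; rewrite mxE !mulrA.
Qed.

Lemma formC (R : realType) (A : 'M[R]_3) (u v : 'rV[R]_3) :
  A^T = A -> form A u v = form A v u.
Proof.
move=> sA; rewrite /form exchange_big; apply: eq_bigr => i _.
by apply: eq_bigr => j _; rewrite -[in LHS]sA mxE; ring.
Qed.

Lemma form_row (R : realType) (A : 'M[R]_3) (u v : 'rV[R]_3) :
  form A u v = dot (u *m A) v.
Proof.
rewrite /form /dot exchange_big; apply: eq_bigr => j _.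
by rewrite mxE mulr_suml.
Qed.

Lemma formDmx (R : realType) (A B : 'M[R]_3) (u v : 'rV[R]_3) :
  form (A + B) u v = form A u v + form B u v.
Proof. by rewrite !form_row mulmxDr dotDl. Qed.

Lemma formZmx (R : realType) (A : 'M[R]_3) (c : R) (u v : 'rV[R]_3) :
  form (c *: A) u v = c * form A u v.
Proof. by rewrite !form_row -scalemxAr dotZl. Qed.

Lemma formNmx (R : realType) (A : 'M[R]_3) (u v : 'rV[R]_3) :
  form (- A) u v = - form A u v.
Proof. by rewrite -scaleN1r formZmx mulN1r. Qed.

Lemma form_otimes (R : realType) (a b u v : 'rV[R]_3) :
  form (otimes a b) u v = dot u a * dot b v.
Proof.
rewrite form_row /otimes mulmxA (_ : u *m a^T *m b = dot u a *: b) ?dotZl//.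
apply/rowP => i; rewrite !mxE big_ord1 !mxE; congr (_ * _).
by apply: eq_bigr => j _; rewrite mxE.
Qed.

Lemma continuous_sum3 (R : realType) (T : topologicalType) (F : 'I_3 -> T -> R)
    (x : T) :
  (forall i, {for x, continuous (F i)}) ->
  {for x, continuous (fun t => \sum_i F i t)}.
Proof.
move=> cF; rewrite (_ : (fun t => _) = (fun t => F 0 t + F 1 t + F 2%:R t)).
  by apply: continuousD; [apply: continuousD|]; exact: cF.
by apply/funext => t; rewrite sum3E.
Qed.

Lemma continuous_form (R : realType) (A : 'M[R]_3) :
  continuous (fun u : 'rV[R]_3 => form A u u).
Proof.
move=> u; rewrite /form.
have c i : {for u, continuous (fun u : 'rV[R]_3 => u 0 i)}.
  exact: coord_continuous.
apply: continuous_sum3 => i; apply: continuous_sum3 => j.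
exact: cvgM (cvgM (c i) (@cvg_cst _ _ _ _ _)) (c j).
Qed.

Lemma form1 (R : realType) (u v : 'rV[R]_3) : form 1%:M u v = dot u v.
Proof. by rewrite form_row mulmx1. Qed.

Lemma compact_sphere (R : realType) : compact [set u : 'rV[R]_3 | dot u u = 1].
Proof.
have cK := @rV_compact R 3 (fun=> `[(-1 : R), 1]%classic)
  (fun=> @segment_compact _ _ _).
apply: subclosed_compact cK _.
  rewrite (_ : [set u | _] = (fun u : 'rV[R]_3 => form 1%:M u u) @^-1` [set 1]).
    by apply: preimage_closed => [u _|]; [exact: continuous_form|exact: closed_eq].
  by apply/seteqP; split => u /=; rewrite form1.
move=> u /= u1 i; rewrite /= in_itv /= -ler_norml -[leRHS]sqrtr1.
rewrite -sqrtr_sqr ler_wsqrtr// -u1 /dot (bigD1 i)//= -expr2 lerDl.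
by apply: sumr_ge0 => j _; rewrite -expr2 sqr_ge0.
Qed.

Lemma dot_normalize (R : realType) (u : 'rV[R]_3) : u != 0 ->
  exists2 c : R, 0 < c & dot (c *: u) (c *: u) = 1.
Proof.
move=> u0; have d0 : 0 < dot u u.
  rewrite lt_def dot_ge0 andbT; apply: contra u0 => /eqP/dot_eq0 ->.
  exact: eqxx.
exists (Num.sqrt (dot u u))^-1; first by rewrite invr_gt0 sqrtr_gt0.
rewrite dotZl dotZr mulrA -expr2 exprVn sqr_sqrtr ?dot_ge0//.
by rewrite mulVf// gt_eqF.
Qed.

Lemma form_sqrD (R : realType) (A : 'M[R]_3) (t : R) (u v : 'rV[R]_3) :
  A^T = A ->
  form A (u + t *: v) (u + t *: v) =
  form A u u + 2 * t * form A u v + t ^+ 2 * form A v v.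
Proof.
move=> sA; rewrite formDl formZl !(formC _ (u + _))// !formDl !formZl.
by rewrite (formC v u)//; ring.
Qed.

(* A maximizer of the quadratic form on the sphere is an eigenvector, since the
   nonnegative form [l |u|^2 - A(u, u)] vanishes there. *)
Lemma lambda_max_eigenvector (R : realType) (A : 'M[R]_3) : A^T = A ->
  exists n : 'rV[R]_3, [/\ dot n n = 1, n *m A = lambda_max A *: n &
    forall u, form A u u <= lambda_max A * dot u u].
Proof.
move=> sA; pose S := [set u : 'rV[R]_3 | dot u u = 1].
have S0 : S !=set0.
  have [|c _ c1] := @dot_normalize R (delta_mx 0 0); last by eexists; exact: c1.
  apply/eqP => /rowP/(_ 0); rewrite !mxE !eqxx /= => /eqP.
  by rewrite oner_eq0.
have cf : {within S, continuous (fun u => form A u u)}.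
  by apply/continuous_subspaceT/continuous_form.
have [n /set_mem n1 nmax] := compact_EVT_max S0 (@compact_sphere R) cf.
rewrite /S /= in n1.
pose l := form A n n.
have lub u : form A u u <= l * dot u u.
  have [->|u0] := eqVneq u 0.
    by rewrite -(scale0r 0) formZl dotZl !mul0r mulr0.
  have [c c0 c1] := dot_normalize u0.
  have := nmax (c *: u); rewrite inE => /(_ c1).
  rewrite formZl formC// formZl => le1.
  have -> : dot u u = (c * c)^-1.
    apply: (mulfI (x := c * c)); first by rewrite mulf_neq0 ?gt_eqF.
    by rewrite mulfV ?mulf_neq0 ?gt_eqF// -c1 dotZl dotZr mulrA.
  by rewrite ler_pdivlMr ?mulr_gt0// mulrC -mulrA.
have nA : n *m A = l *: n.
  apply/eqP; rewrite -subr_eq0; apply/eqP/dot_eq0.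
  set y := n *m A - l *: n.
  have ny : form A n y - l * dot n y = dot y y.
    by rewrite form_row -dotZl -mulN1r -dotZl -dotDl scaleN1r.
  have q (t : R) : 0 <= - 2 * t * dot y y + t ^+ 2 * (l * dot y y - form A y y).
    have := lub (n + t *: y).
    rewrite form_sqrD// -form1 form_sqrD ?trmx1// !form1 -ny n1 -/l.
    move: (form A n y) (form A y y) (dot n y) (dot y y) => a b c d; lra.
  set D := dot y y in q *; set E := l * D - _ in q.
  apply/eqP/negPn/negP => D0.
  have Dp : 0 < D by rewrite lt_def D0 dot_ge0.
  have E1 : 0 < `|E| + 1 by rewrite ltr_wpDl.
  (* At this [t] the quadratic polynomial equals [D ^+ 2 / (|E| + 1)] times [E / (|E| + 1) - 2],
     which is negative: the first variation dominates. *)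
  have := q (D / (`|E| + 1)).
  rewrite (_ : _ + _ = D ^+ 2 / (`|E| + 1) * (E / (`|E| + 1) - 2)).
    rewrite pmulr_rge0 ?divr_gt0 ?exprn_gt0//.
    rewrite subr_ge0 ler_pdivlMr//; have := ler_norm E; have := normr_ge0 E; lra.
  by field; rewrite gt_eqF.
have n0 : n != 0.
  apply/eqP => n0; move: n1; rewrite n0 -(scale0r 0) dotZl mul0r => /eqP.
  by rewrite eq_sym oner_eq0.
have le a : eigenvalue A a -> a <= l.
  move=> /eigenvalueP[v vA v0]; have := lub v; rewrite form_row vA dotZl.
  rewrite ler_pM2r// lt_def dot_ge0 andbT; apply: contra v0 => /eqP/dot_eq0 ->.
  exact: eqxx.
have el : eigenvalue A l by apply/eigenvalueP; exists n.
suff -> : lambda_max A = l by exists n.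
apply/eqP; rewrite eq_le; apply/andP; split.
  by apply: ge_sup; [exists l|exact: le].
by apply: ub_le_sup => //; exists l; exact: le.
Qed.

Lemma lambda_max_le (R : realType) (A : 'M[R]_3) (b : R) : A^T = A ->
  (forall u, form A u u <= b * dot u u) -> lambda_max A <= b.
Proof.
move=> /lambda_max_eigenvector[n [n1 nA _]] /(_ n).
by rewrite form_row nA dotZl n1 !mulr1.
Qed.

(** A 3 by 2 matrix has a nonzero left kernel whatever its columns. In particular [m = 0] is
    allowed, which occurs when [g] is parallel to the eigenvector. *)
Lemma exists_unit_orthogonal (R : realType) (n m : 'rV[R]_3) :
  exists xi : 'rV[R]_3, [/\ dot xi xi = 1, dot n xi = 0 & dot m xi = 0].
Proof.
pose M : 'M[R]_(3, 2) := \matrix_(i, j) (if j == 0 then n 0 i else m 0 i).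
have k0 : kermx M != 0.
  rewrite kermx_eq0 /row_free; apply/eqP => M3.
  by have := rank_leq_col M; rewrite M3.
have := nz_row_sub (kermx M); rewrite sub_kermx.
set u := nz_row _ => /eqP uM.
have u0 : u != 0 by rewrite nz_row_eq0.
have [c c0 c1] := dot_normalize u0; exists (c *: u).
split=> //; rewrite dotZr dotC.
  have := congr1 (fun B : 'M[R]_(1, 2) => B 0 0) uM; rewrite !mxE => e0.
  rewrite [X in _ * X](_ : _ = 0) ?mulr0// -[RHS]e0.
  by apply: eq_bigr => i _; rewrite mxE.
have := congr1 (fun B : 'M[R]_(1, 2) => B 0 1) uM; rewrite !mxE => e0.
rewrite [X in _ * X](_ : _ = 0) ?mulr0// -[RHS]e0.
by apply: eq_bigr => i _; rewrite mxE.
Qed.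

(** Each [|u_i u_j|] is at most [(u_i^2 + u_j^2) / 2], and the nine halves add up to [3 |u|^2]. *)
Lemma form_le_perturb (R : realType) (A B : 'M[R]_3) (eps : R) (u : 'rV[R]_3) :
  (forall i j, `|A i j - B i j| <= eps) ->
  form A u u <= form B u u + 3 * eps * dot u u.
Proof.
move=> AB; rewrite -lerBlDl -formNmx -formDmx.
have -> : 3 * eps * dot u u =
    \sum_(i < 3) \sum_(j < 3) eps * ((u 0 i * u 0 i + u 0 j * u 0 j) / 2).
  by rewrite /dot !sum3E; field.
apply: ler_sum => i _; apply: ler_sum => j _; rewrite !mxE.
have := AB i j; set a := _ - _ => aE.
apply: (le_trans (ler_norm _)); rewrite !normrM mulrAC mulrC.
apply: ler_pM => //.
have := sqr_ge0 (`|u 0 i| - `|u 0 j|).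
rewrite -!expr2 -(real_normK (num_real (u 0 i))) -(real_normK (num_real (u 0 j))).
move: `|_| `|_| => x y; rewrite sqrrB; lra.
Qed.

Lemma sqnormE (R : realType) (u : 'rV[R]_3) : sqnorm u = dot u u.
Proof. by apply: eq_bigr => i _; rewrite expr2. Qed.

Lemma trmx_otimes (R : realType) (a b : 'rV[R]_3) :
  (otimes a b)^T = otimes b a.
Proof. by rewrite /otimes trmx_mul trmxK. Qed.

Lemma form_delta (R : realType) (A : 'M[R]_3) (i : 'I_3) :
  form A (delta_mx 0 i) (delta_mx 0 i) = A i i.
Proof.
rewrite form_row -rowE /dot (bigD1 i)//= !mxE !eqxx mulr1 big1 ?addr0// => j ji.
by rewrite !mxE (negPf ji) andbF mulr0.
Qed.

Lemma dot_delta (R : realType) (u : 'rV[R]_3) (i : 'I_3) :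
  dot (delta_mx 0 i) u = u 0 i.
Proof.
rewrite /dot (bigD1 i)//= !mxE !eqxx mul1r big1 ?addr0// => j ji.
by rewrite !mxE (negPf ji) andbF mul0r.
Qed.

(* With [n] the top eigenvector of [N = 2/3 e I - (g g / r - W)] and
   [m = g - (g . n) n], the terms of the perturbed matrix which are linear in
   [s] add up to a multiple of [n n], so that
   [N] is only changed by [- (2 s h (g . n) + s^2 h^2) / r] times [n n]. *)
Lemma oscillation_direction (R : realType) (ebar e r : R) (g : 'rV[R]_3)
    (W : 'M[R]_3) :
  0 < ebar -> 0 < r -> e <= ebar -> sym_traceless W ->
  3 / 2 * lambda_max (r^-1 *: otimes g g - W) < e ->
  0 < e - 1 / 2 * (sqnorm g / r) /\
  exists (n xi m : 'rV[R]_3) (h kappa : R),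
  [/\ [/\ dot n n = 1, dot xi xi = 1, dot n xi = 0, dot m n = 0 & dot m xi = 0],
      0 < kappa,
      (e - 1 / 2 * (sqnorm g / r)) ^+ 2 / (36 * ebar) <= h ^+ 2 / r &
      forall s u, `|s| <= 1 ->
        form (r^-1 *: otimes (g + (s * h) *: n) (g + (s * h) *: n) -
          (W + (s * (h / r)) *: (otimes n m + otimes m n))) u u <=
        (2 / 3 * e - kappa) * dot u u].
Proof.
move=> E0 r0 eE [sW tW]; set M := r^-1 *: _ - W => Me.
have sM : M^T = M by rewrite /M linearB linearZ /= trmx_otimes sW.
have [_ [_ _ Mle]] := lambda_max_eigenvector sM.
pose k0 := 2 / 3 * e - lambda_max M; have k00 : 0 < k0 by rewrite /k0; lra.
have sNM : (- M)^T = - M by rewrite linearN /= sM.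
have [n [n1 nM NMle]] := lambda_max_eigenvector sNM.
(* [lambda_max (- M)] is minus the smallest eigenvalue of [M], so [mu] is the largest eigenvalue of
   [N = 2/3 e I - M], while [k0] is the smallest. *)
pose mu := 2 / 3 * e + lambda_max (- M).
have Nge u : k0 * dot u u <= 2 / 3 * e * dot u u - form M u u.
  by have := Mle u; rewrite /k0; lra.
have Nle u : 2 / 3 * e * dot u u - form M u u <= mu * dot u u.
  by have := NMle u; rewrite formNmx /mu; lra.
have Mn u : form M n u = (2 / 3 * e - mu) * dot n u.
  by rewrite -[M]opprK formNmx form_row nM dotZl /mu; ring.
(* Removing from [u] its component along [n] splits the form [N] orthogonally; what remains is
   nonnegative because [N] is positive. *)
have Nn u : mu * dot n u ^+ 2 <= 2 / 3 * e * dot u u - form M u u.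
  have := Nge (u + (- dot n u) *: n).
  rewrite -form1 !form_sqrD ?trmx1// !form1 (formC u n)// !Mn (dotC u n) n1.
  have : 0 <= k0 * (dot u u + 2 * - dot n u * dot n u + (- dot n u) ^+ 2 * 1).
    rewrite mulr_ge0 ?(ltW k00)//; have := dot_ge0 (u + (- dot n u) *: n).
    by rewrite -[X in _ <= X -> _]form1 form_sqrD ?trmx1// !form1 (dotC u n) n1.
  move=> /le_trans h /h; move: (dot u u) (form M u u) (dot n u) => a b c; lra.
have mu0 : 0 < mu by have := Nge n; rewrite Mn n1; lra.
set G := sqnorm g / r; set delta := e - _.
have trN : \sum_i (2 / 3 * e - M i i) = 2 * delta.
  rewrite sumrB sumr_const card_ord -/(\tr M) /M linearB linearZ /= tW.
  have -> : \tr (otimes g g) = sqnorm g.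
    rewrite /mxtrace /sqnorm; apply: eq_bigr => i _.
    by rewrite !mxE big_ord1 !mxE expr2.
  by rewrite /delta /G -mulr_natr; field; rewrite gt_eqF.
have d1 i : dot (delta_mx 0 i) (delta_mx 0 i) = 1 :> R.
  by rewrite dot_delta !mxE !eqxx.
(* [2 * delta] is the trace of [N]: at most three times the largest eigenvalue, and at least that
   eigenvalue since the others are positive. *)
have delta_le : 2 * delta <= 3 * mu.
  rewrite -trN -mulr_natl (_ : 3 * mu = \sum_(i < 3) mu); last first.
    by rewrite sumr_const card_ord mulr_natl.
  by apply: ler_sum => i _; have := Nle (delta_mx 0 i); rewrite d1 form_delta; lra.
have delta_ge : mu <= 2 * delta.
  rewrite -trN -[leLHS]mulr1 -[X in _ * X]n1 /dot mulr_sumr.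
  apply: ler_sum => i _; have := Nn (delta_mx 0 i).
  by rewrite d1 form_delta dotC dot_delta expr2; lra.
have G0 : 0 <= G by rewrite divr_ge0 ?(ltW r0)// sqnormE dot_ge0.
have deltaE : 2 * delta = 2 * e - G by rewrite /delta; lra.
split; first by lra.
pose m := g - dot g n *: n.
have mn : dot m n = 0 by rewrite /m -scaleNr dotDl dotZl n1; ring.
have [xi [x1 nx mx]] := exists_unit_orthogonal n m.
(* The factor 16 leaves room: with [|g|^2 / r <= 2 ebar] the linear term satisfies
   [(2 x)^2 <= mu^2 / 2 <= (3/4 mu)^2], and [mu <= 2 ebar] bounds the quadratic term by [mu / 8].
   Together they use 7/8 of [mu], and an eighth of [N] survives, whence [kappa = k0 / 8]. The 36 in
   the conclusion comes from [delta <= 3/2 mu]. *)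
pose h := Num.sqrt (r * mu ^+ 2 / (16 * ebar)).
have h2 : h ^+ 2 = r * mu ^+ 2 / (16 * ebar).
  by rewrite sqr_sqrtr// divr_ge0 ?mulr_ge0 ?sqr_ge0 ?ltW.
exists n, xi, m, h, (k0 / 8); split => //; first by lra.
  rewrite h2 (_ : _ / r = (3 / 2 * mu) ^+ 2 / (36 * ebar)); last first.
    by field; rewrite !gt_eqF.
  rewrite ler_pM2r ?invr_gt0 ?mulr_gt0// ler_sqr ?nnegrE; lra.
have gn2 : dot g n ^+ 2 <= sqnorm g.
  have := dot_ge0 m; rewrite /m -scaleNr -form1 form_sqrD ?trmx1// !form1.
  by rewrite n1 sqnormE; lra.
pose x := h * dot g n / r.
have x2 : (2 * x) ^+ 2 <= (3 / 4 * mu) ^+ 2.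
  have -> : (2 * x) ^+ 2 = 4 * (h ^+ 2) * dot g n ^+ 2 / r ^+ 2.
    by rewrite /x; field; rewrite gt_eqF.
  rewrite h2 (_ : _ / r ^+ 2 = mu ^+ 2 / (4 * ebar) * (dot g n ^+ 2 / r)); last first.
    by field; rewrite !gt_eqF.
  have : dot g n ^+ 2 / r <= 2 * ebar.
    apply: (@le_trans _ _ G); last by lra.
    by rewrite /G ler_pM2r ?invr_gt0.
  have q0 : 0 <= mu ^+ 2 / (4 * ebar) by rewrite divr_ge0 ?sqr_ge0// ltW ?mulr_gt0.
  move=> /(ler_wpM2l q0)/le_trans; apply.
  rewrite (_ : mu ^+ 2 / (4 * ebar) * (2 * ebar) = mu ^+ 2 / 2); last by field; rewrite gt_eqF.
  have := sqr_ge0 mu; lra.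
have hr : h ^+ 2 / r <= mu / 8.
  rewrite h2 (_ : _ / r = mu * (mu / (16 * ebar))); last by field; rewrite !gt_eqF.
  by rewrite ler_pM2l// ler_pdivrMr ?mulr_gt0//; lra.
move=> s u s1.
have tau : s * (2 * x) + s ^+ 2 * (h ^+ 2 / r) <= 7 / 8 * mu.
  have s2 : s ^+ 2 <= 1 by rewrite -(real_normK (num_real s)) expr_le1.
  have t1 : s * (2 * x) <= 3 / 4 * mu.
    apply: (le_trans (ler_norm _)); rewrite normrM.
    apply: (@le_trans _ _ `|2 * x|); first by rewrite ler_piMl.
    by rewrite -ler_sqr ?nnegrE ?real_normK ?num_real//; lra.
  have : s ^+ 2 * (h ^+ 2 / r) <= h ^+ 2 / r.
    by rewrite ler_piMl// divr_ge0 ?sqr_ge0 ?ltW.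
  lra.
have -> : form (r^-1 *: otimes (g + (s * h) *: n) (g + (s * h) *: n) -
    (W + (s * (h / r)) *: (otimes n m + otimes m n))) u u =
    form M u u + (s * (2 * x) + s ^+ 2 * (h ^+ 2 / r)) * dot n u ^+ 2.
  rewrite /M !(formDmx, formNmx, formZmx, form_otimes) /m -scaleNr.
  rewrite !(dotDl, dotDr, dotZl, dotZr) (dotC u g) (dotC u n) /x.
  by field; rewrite gt_eqF.
have := ler_wpM2r (sqr_ge0 (dot n u)) tau.
have := Nge u; have := Nn u.
move: (dot u u) (form M u u) (dot n u ^+ 2) (_ * (2 * x) + _) => a b c d; lra.
Qed.

(** * Cells and measurability *)

Notation mspacetime R :=
  (measurableTypeR R * measurableTypeR R * measurableTypeR R
   * measurableTypeR R)%type.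

(** Half-open, so that the cubes of a grid partition the space exactly; closed boxes serve as
    supports inside them. *)
Definition hcube (R : realType) (c : spacetime R) (rho : R) :
    set (spacetime R) :=
  `[c.1.1.1 - rho, c.1.1.1 + rho[ `*` `[c.1.1.2 - rho, c.1.1.2 + rho[ `*`
  `[c.1.2 - rho, c.1.2 + rho[ `*` `[c.2 - rho, c.2 + rho[.

Lemma box_sub_hcube (R : realType) (c : spacetime R) (rho rho' : R) :
  rho' < rho -> box c rho' `<=` hcube c rho.
Proof.
move=> rr; have inc (a x : R) : x \in `[a - rho', a + rho'] ->
    x \in `[a - rho, a + rho[%R.
  by rewrite !in_itv /= => /andP[? ?]; apply/andP; split; lra.
by move=> q [[[/inc ? /inc ?] /inc ?] /inc ?].
Qed.

Lemma measurable_box (R : realType) (c : spacetime R) (rho : R) :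
  measurable (box c rho : set (mspacetime R)).
Proof. by do !apply: measurableX; exact: measurable_itv. Qed.

Lemma measurable_hcube (R : realType) (c : spacetime R) (rho : R) :
  measurable (hcube c rho : set (mspacetime R)).
Proof. by do !apply: measurableX; exact: measurable_itv. Qed.

Lemma lebesgue4_setX (R : realType) (A B C D : set (measurableTypeR R)) :
  measurable A -> measurable B -> measurable C -> measurable D ->
  lebesgue4 R (A `*` B `*` C `*` D) =
  (@lebesgue_measure R A * @lebesgue_measure R B * @lebesgue_measure R C
   * @lebesgue_measure R D)%E.
Proof.
move=> mA mB mC mD; have mAB := measurableX mA mB.
have mABC := measurableX mAB mC.
apply: (etrans (product_measure1E _ _ mABC mD)); congr (_ * _)%E.
apply: (etrans (product_measure1E _ _ mAB mC)); congr (_ * _)%E.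
exact: (product_measure1E _ _ mA mB).
Qed.

Lemma lebesgue4_box (R : realType) (c : spacetime R) (rho : R) : 0 < rho ->
  lebesgue4 R (box c rho) = ((2 * rho) ^+ 4)%:E.
Proof.
move=> r0; rewrite lebesgue4_setX; do ?exact: measurable_itv.
have len (a : R) : @lebesgue_measure R `[a - rho, a + rho]%classic = (2 * rho)%:E.
  rewrite lebesgue_measure_itv /= lte_fin ifT; last lra.
  by congr EFin; ring.
by rewrite !len; congr EFin; ring.
Qed.

Lemma lebesgue4_hcube (R : realType) (c : spacetime R) (rho : R) : 0 < rho ->
  lebesgue4 R (hcube c rho) = ((2 * rho) ^+ 4)%:E.
Proof.
move=> r0; rewrite lebesgue4_setX; do ?exact: measurable_itv.
have len (a : R) : @lebesgue_measure R `[a - rho, a + rho[%classic = (2 * rho)%:E.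
  rewrite lebesgue_measure_itv /= lte_fin ifT; last lra.
  by congr EFin; ring.
by rewrite !len; congr EFin; ring.
Qed.

Definition cell_index (R : realType) (rho : R) (p : spacetime R) :
    int * int * int * int :=
  (Num.floor (p.1.1.1 / (2 * rho)), Num.floor (p.1.1.2 / (2 * rho)),
   Num.floor (p.1.2 / (2 * rho)), Num.floor (p.2 / (2 * rho))).

Definition cell_center (R : realType) (rho : R) (z : int * int * int * int) :
    spacetime R :=
  let f (k : int) := (2 * k%:~R + 1) * rho in
  (f z.1.1.1, f z.1.1.2, f z.1.2, f z.2).

Definition cell (R : realType) (rho : R) (z : int * int * int * int) :=
  hcube (cell_center rho z) rho.

Lemma cellP (R : realType) (rho : R) (z : int * int * int * int)
    (p : spacetime R) :
  0 < rho -> cell rho z p <-> cell_index rho p = z.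
Proof.
move=> r0; have I (x : R) (k : int) :
    (x \in `[(2 * k%:~R + 1) * rho - rho, (2 * k%:~R + 1) * rho + rho[%R) <->
    Num.floor (x / (2 * rho)) = k.
  rewrite in_itv /=.
  rewrite (_ : (2 * k%:~R + 1) * rho - rho = k%:~R * (2 * rho)); last by ring.
  rewrite (_ : (2 * k%:~R + 1) * rho + rho = (k + 1)%:~R * (2 * rho)); last first.
    by rewrite intrD; ring.
  have r2 : 0 < 2 * rho by lra.
  rewrite -ler_pdivlMr// -ltr_pdivrMr//.
  by split => [/floor_def//|<-]; exact: floor_itv.
case: z => [[[z1 z2] z3] z4]; rewrite /cell /hcube /cell_index /=.
split => [[[[/I -> /I ->] /I ->] /I ->]//|[z1E z2E z3E z4E]].
by split; [split; [split|]|]; apply/I.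
Qed.

Lemma hcube_near (R : realType) (c p q : spacetime R) (rho : R) :
  hcube c rho p -> hcube c rho q -> ball p (2 * rho) q.
Proof.
have B (x y a : R) : x \in `[a - rho, a + rho[%R -> y \in `[a - rho, a + rho[%R ->
    ball x (2 * rho) y.
  rewrite !in_itv /= => /andP[x1 x2] /andP[y1 y2].
  by rewrite /ball /= ltr_norml; apply/andP; split; lra.
move=> [[[/= p1 p2] p3] p4] [[[/= q1 q2] q3] q4].
by split; [split; [split|]|] => /=; apply: B; eassumption.
Qed.

(** The cube need only contain [p], not be centred there: two of its points differ by less than
    [2 * rho] in each coordinate, hence the radius [eta / 2]. *)
Lemma nbhs_hcube (R : realType) (A : set (spacetime R)) (p : spacetime R) :
  nbhs p A -> exists2 eta : R, 0 < eta &
    forall c rho, rho < eta -> hcube c rho p -> hcube c rho `<=` A.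
Proof.
move=> /nbhs_ballP[eta /= eta0 etaA].
exists (eta / 2) => [|c rho rhoe cp q cq]; first by lra.
by apply: (etaA); apply: le_ball (hcube_near cp cq); lra.
Qed.

Definition mesh (R : realType) (N : nat) : R := (2 * N.+1%:R)^-1.

Lemma mesh_gt0 (R : realType) (N : nat) : 0 < mesh R N.
Proof. by rewrite invr_gt0 mulr_gt0. Qed.

Lemma mesh_lt (R : realType) (eta : R) : 0 < eta ->
  \forall N \near \oo, mesh R N < eta.
Proof.
move=> e0; apply: filterS (near_infty_natSinv_lt (PosNum e0)) => N /=.
apply: le_lt_trans; rewrite lef_pV2 ?posrE ?mulr_gt0// mulr_natl mulr2n.
by rewrite lerDl.
Qed.

(** Every point of an open set has its cell inside the set once the grid is fine enough, so the set
    is a countable union of products of intervals. This links the topology to the product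
    sigma-algebra. *)
Lemma open_measurable4 (R : realType) (A : set (spacetime R)) :
  open A -> measurable (A : set (mspacetime R)).
Proof.
move=> oA; pose F (N : nat) (z : int * int * int * int) : set (mspacetime R) :=
  if `[< cell (mesh R N) z `<=` A >] then cell (mesh R N) z else set0.
have -> : A = \bigcup_N \bigcup_z F N z.
  apply/seteqP; split => [p Ap|p [N _ [z _]]]; last first.
    by rewrite /F; case: asboolP => //= zA; exact: zA.
  have [eta eta0 etaA] := nbhs_hcube (open_nbhs_nbhs (conj oA Ap)).
  have [N _ Neta] : \forall N \near \oo, mesh R N < eta := mesh_lt eta0.
  exists N => //; exists (cell_index (mesh R N) p) => //.
  have pz : cell (mesh R N) (cell_index (mesh R N) p) p.
    by apply/cellP => //; exact: mesh_gt0.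
  rewrite /F; case: asboolP => // nA; case: nA.
  exact: (etaA _ _ (Neta N (leqnn N)) pz).
have mF N z : measurable (F N z).
  by rewrite /F; case: ifP => // _; exact: measurable_hcube.
apply: bigcupT_measurable => N.
exact: (countable_bigcupT_measurable (countableP _) (mF N)).
Qed.

Lemma measurable_fun_open4 (R : realType) (U : set (spacetime R))
    (f : spacetime R -> R) :
  open U -> (forall p, U p -> {for p, continuous f}) ->
  measurable_fun (U : set (mspacetime R)) f.
Proof.
move=> oU cf mU; apply: (measurability _ (@RGenOpens.measurableE R)) => //.
move=> _ [_ [a [b ->] <-]].
apply: open_measurable4; rewrite openE => p [Up fp].
apply: filterI; first exact: open_nbhs_nbhs.
by apply: (cf p Up); apply: open_nbhs_nbhs; split => //; exact: interval_open.
Qed.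

(** * The construction in a small cube *)

(** One entry of [(g + w) (g + w) / r], compared with its frozen value uniformly in the phase value
    [s]. The tolerance [2 * d] adds the error on [g] to the error on [w]. *)
Lemma product_perturb (R : realType) (t a b x y eps : R) : 0 < eps ->
  \forall d \near 0^'+, forall t' a' b' s, `|s| <= 1 -> `|t' - t| <= d ->
    `|a' - a| <= 2 * d -> `|b' - b| <= 2 * d ->
    `|t' * ((a' + s * x) * (b' + s * y)) - t * ((a + s * x) * (b + s * y))|
      <= eps.
Proof.
(* [K] bounds each factor after perturbation; telescoping the difference gives errors [d], [2 d] and
   [2 d] times [K * K], hence the 5. *)
move=> eps0; pose K := `|a| + `|b| + `|x| + `|y| + `|t| + 1.
have a0 := normr_ge0 a; have b0 := normr_ge0 b; have x0 := normr_ge0 x.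
have y0 := normr_ge0 y; have t0 := normr_ge0 t.
have K1 : 1 <= K by rewrite /K; lra.
have KK : 0 < 5 * (K * K) by rewrite !mulr_gt0//; lra.
near=> d => t' a' b' s s1 t'd a'd b'd.
have d0 : 0 < d by [].
have d2 : d <= 1 / 2 by near: d; apply: nbhs_right_le; lra.
have dK : 5 * (K * K) * d <= eps.
  by rewrite mulrC -ler_pdivlMr//; near: d; apply: nbhs_right_le; rewrite divr_gt0.
have sz (z : R) : `|s * z| <= `|z| by rewrite normrM ler_piMl.
have close (z z' : R) : `|z' - z| <= 2 * d -> `|z'| <= `|z| + 1.
  by move=> zz; have := ler_normD (z' - z) z; rewrite subrK; lra.
have A' : `|a' + s * x| <= K.
  by have := ler_normD a' (s * x); have := sz x; have := close _ _ a'd; rewrite /K; lra.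
have B' : `|b' + s * y| <= K.
  by have := ler_normD b' (s * y); have := sz y; have := close _ _ b'd; rewrite /K; lra.
have A : `|a + s * x| <= K.
  by have := ler_normD a (s * x); have := sz x; rewrite /K; lra.
have T : `|t| <= K by rewrite /K; lra.
have -> : t' * ((a' + s * x) * (b' + s * y)) - t * ((a + s * x) * (b + s * y)) =
    (t' - t) * ((a' + s * x) * (b' + s * y)) +
    ((a' - a) * (t * (b' + s * y)) + (b' - b) * (t * (a + s * x))) by ring.
apply: le_trans dK; apply: (le_trans (ler_normD _ _)).
have e1 : `|(t' - t) * ((a' + s * x) * (b' + s * y))| <= d * (K * K).
  by rewrite !normrM ler_pM ?mulr_ge0// ler_pM.
have e2 : `|(a' - a) * (t * (b' + s * y))| <= 2 * d * (K * K).
  by rewrite !normrM ler_pM ?mulr_ge0// ler_pM.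
have e3 : `|(b' - b) * (t * (a + s * x))| <= 2 * d * (K * K).
  by rewrite !normrM ler_pM ?mulr_ge0// ler_pM.
have := ler_normD ((a' - a) * (t * (b' + s * y))) ((b' - b) * (t * (a + s * x))).
lra.
Unshelve. all: by end_near. Qed.

Lemma perturbed_subsolution (R : realType) (kappa r0 e0 h : R)
    (g0 n m : 'rV[R]_3) (W0 : 'M[R]_3) :
  0 < kappa ->
  (forall s u, `|s| <= 1 ->
    form (r0^-1 *: otimes (g0 + (s * h) *: n) (g0 + (s * h) *: n) -
      (W0 + (s * (h / r0)) *: (otimes n m + otimes m n))) u u <=
    (2 / 3 * e0 - kappa) * dot u u) ->
  \forall d \near 0^'+, forall (r e s : R) (g w : 'rV[R]_3) (W V : 'M[R]_3),
    `|s| <= 1 -> `|r^-1 - r0^-1| <= d -> `|e - e0| <= d ->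
    (forall i, `|g 0 i - g0 0 i| <= d) ->
    (forall i j, `|W i j - W0 i j| <= d) ->
    (forall i, `|w 0 i - s * (h * n 0 i)| <= d) ->
    (forall i j, `|V i j - s * (h / r0 * (n 0 i * m 0 j + n 0 j * m 0 i))| <= d) ->
    W^T = W -> V^T = V ->
    3 / 2 * lambda_max (r^-1 *: otimes (g + w) (g + w) - (W + V)) < e.
Proof.
move=> k0 H.
have P : \forall d \near (0 : R)^'+, forall i j : 'I_3, forall t' a' b' s,
    `|s| <= 1 -> `|t' - r0^-1| <= d ->
    `|a' - g0 0 i| <= 2 * d -> `|b' - g0 0 j| <= 2 * d ->
    `|t' * ((a' + s * (h * n 0 i)) * (b' + s * (h * n 0 j))) -
      r0^-1 * ((g0 0 i + s * (h * n 0 i)) * (g0 0 j + s * (h * n 0 j)))|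
      <= kappa / 24.
  apply: filter_forall => i; apply: filter_forall => j.
  by apply: product_perturb; lra.
near=> d => r e s g w W V s1 rd ed gd Wd wd Vd sW sV.
(* Budget: an entry moves by at most [kappa / 24 + 2 d <= kappa / 12], which costs [kappa / 4] in
   the form, and replacing [e0] by [e] costs [2/3 d]. More than [kappa / 2] is left. *)
have dk : d <= kappa / 48 by near: d; apply: nbhs_right_le; lra.
have Pd : forall i j : 'I_3, forall t' a' b' s,
    `|s| <= 1 -> `|t' - r0^-1| <= d ->
    `|a' - g0 0 i| <= 2 * d -> `|b' - g0 0 j| <= 2 * d ->
    `|t' * ((a' + s * (h * n 0 i)) * (b' + s * (h * n 0 j))) -
      r0^-1 * ((g0 0 i + s * (h * n 0 i)) * (g0 0 j + s * (h * n 0 j)))|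
      <= kappa / 24 by near: d.
set A := r^-1 *: _ - _.
set A0 := r0^-1 *: otimes (g0 + (s * h) *: n) (g0 + (s * h) *: n) -
      (W0 + (s * (h / r0)) *: (otimes n m + otimes m n)).
have AA0 i j : `|A i j - A0 i j| <= kappa / 12.
  have gw k : `|(g 0 k + (w 0 k - s * (h * n 0 k))) - g0 0 k| <= 2 * d.
    have := ler_normD (g 0 k - g0 0 k) (w 0 k - s * (h * n 0 k)).
    rewrite addrAC; have := gd k; have := wd k; lra.
  have := Pd i j _ _ _ _ s1 rd (gw i) (gw j); rewrite !addrA !subrK.
  have := Wd i j; have := Vd i j.
  rewrite /A /A0 !mxE !big_ord1 !mxE.
  set p1 := _ - s * (h / r0 * _); set p2 := _ - W0 i j; set p3 := _ - r0^-1 * _.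
  move=> v1 v2 v3.
  rewrite [X in `|X|](_ : _ = p3 - p2 - p1); last by rewrite /p1 /p2 /p3; ring.
  have := ler_normB (p3 - p2) p1; have := ler_normB p3 p2; lra.
have sA : A^T = A by rewrite /A linearB linearD linearZ /= trmx_otimes sW sV.
suff : lambda_max A <= 2 / 3 * e - kappa / 2 by lra.
apply: lambda_max_le sA _ => u; apply: (le_trans (form_le_perturb u AA0)).
apply: (@le_trans _ _ ((2 / 3 * e0 - kappa + 3 * (kappa / 12)) * dot u u)).
  have := H s u s1; rewrite -/A0.
  by move: (form A0 u u) (dot u u) => a b; lra.
rewrite ler_wpM2r ?dot_ge0//; move: ed; rewrite ler_norml => /andP[]; lra.
Unshelve. all: by end_near. Qed.

Definition solves (R : realType) (Ew : 'I_3 -> expr R)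
    (EV : 'I_3 -> 'I_3 -> expr R) : Prop :=
  [/\ forall i p, eval (dexpr (basis_vec R ord0) (Ew i)) p +
        \sum_j eval (dexpr (basis_vec R (lift ord0 j)) (EV i j)) p = 0,
      forall p, \sum_j eval (dexpr (basis_vec R (lift ord0 j)) (Ew j)) p = 0,
      forall i j p, eval (EV i j) p = eval (EV j i) p &
      forall p, \sum_i eval (EV i i) p = 0].

Definition vfield (R : realType) (Ew : 'I_3 -> expr R) :
    spacetime R -> 'rV[R]_3 := eval_mx (fun=> Ew).

Lemma vanishes_offD (R : realType) (K : set (spacetime R)) (f1 f2 : expr R) :
  vanishes_off K f1 -> vanishes_off K f2 -> vanishes_off K (Add f1 f2).
Proof. by move=> h1 h2 p Kp /=; rewrite h1// h2// addr0. Qed.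

Lemma vanishes_offZ (R : realType) (K : set (spacetime R)) (c : R)
    (f : expr R) : vanishes_off K f -> vanishes_off K (Scale c f).
Proof. by move=> h p Kp /=; rewrite h// mulr0. Qed.

Lemma vanishes_offM (R : realType) (K : set (spacetime R)) (f1 f2 : expr R) :
  vanishes_off K f1 -> vanishes_off K (Mul f1 f2).
Proof. by move=> h p Kp /=; rewrite h// mul0r. Qed.

Section vanishing.
Variables (R : realType) (K : set (spacetime R)) (n xi m : 'rV[R]_3).
Hypothesis clK : closed K.
Variable psi : expr R.
Hypothesis psiK : vanishes_off K psi.

Lemma vanishes_off_velocity (h : R) (i : 'I_3) :
  vanishes_off K (velocity n xi h psi i).
Proof.
rewrite /velocity /Yop /Lop; apply: vanishes_offZ.
by apply: vanishes_offD; apply: vanishes_offZ;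
  apply: (vanishes_off_dexpr _ clK); apply: vanishes_offD;
  do 2 apply: (vanishes_off_dexpr _ clK).
Qed.

Lemma vanishes_off_stress (h c : R) (i j : 'I_3) :
  vanishes_off K (stress n xi m h c psi i j).
Proof.
have D := fun v f => @vanishes_off_dexpr R K f v clK.
have Y l f : vanishes_off K f -> vanishes_off K (Yop n xi l f).
  by move=> fK; rewrite /Yop /Xop; apply: vanishes_offD; apply: vanishes_offZ; exact: D.
have X l f : vanishes_off K f -> vanishes_off K (Xop n xi l f).
  by move=> fK; rewrite /Yop /Xop; apply: vanishes_offD; apply: vanishes_offZ; exact: D.
have Z l : vanishes_off K (Zop n xi m l psi).
  rewrite /Zop /Lop; apply: vanishes_offD; apply: vanishes_offZ; last exact/D/X.
  by apply: vanishes_offD; do 2 apply: (D).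
rewrite /stress; apply: vanishes_offD; apply: vanishes_offZ.
  by apply: vanishes_offD; apply: (Y).
by apply: (D); apply: vanishes_offD; apply: (Y); exact: X.
Qed.

End vanishing.

(** Pigeonhole between the two phases: if both failed, their energies would add up to less than
    [2 * c0 * A] times the volume of the cube, against at least [B] times the volume
    [(rho / 2) ^+ 4] of the inner box. *)
Lemma energy_pick (R : realType) (c : spacetime R) (rho c0 A B : R)
    (F F1 F2 : spacetime R -> R) :
  0 < rho -> 0 <= c0 -> 0 <= A -> 0 <= B ->
  (forall G, G \in [:: F; F1; F2] ->
     measurable_fun (hcube c rho : set (mspacetime R)) G) ->
  (forall p, hcube c rho p -> 0 <= F p <= A) ->
  (forall p, hcube c rho p -> 0 <= F1 p /\ 0 <= F2 p) ->
  (forall p, box c (rho / 4) p -> B <= F1 p + F2 p) ->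
  2 * (c0 * A * (2 * rho) ^+ 4) <= B * (rho / 2) ^+ 4 ->
  (c0%:E * \int[lebesgue4 R]_(p in hcube c rho) (F p)%:E <=
     \int[lebesgue4 R]_(p in hcube c rho) (F1 p)%:E)%E \/
  (c0%:E * \int[lebesgue4 R]_(p in hcube c rho) (F p)%:E <=
     \int[lebesgue4 R]_(p in hcube c rho) (F2 p)%:E)%E.
Proof.
move=> rho0 c00 A0 B0 mG F0 F120 FB cAB; set Q := hcube c rho.
have mQ : measurable (Q : set (mspacetime R)) by exact: measurable_hcube.
have mC : measurable (box c (rho / 4) : set (mspacetime R)).
  exact: measurable_box.
have mF : measurable_fun (Q : set (mspacetime R)) F by apply: mG; rewrite !inE eqxx.
have mF1 : measurable_fun (Q : set (mspacetime R)) F1.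
  by apply: mG; rewrite !inE eqxx orbT.
have mF2 : measurable_fun (Q : set (mspacetime R)) F2.
  by apply: mG; rewrite !inE eqxx !orbT.
have CQ : box c (rho / 4) `<=` Q by apply: box_sub_hcube; lra.
pose I G := (\int[lebesgue4 R]_(p in Q) (G p)%:E)%E.
rewrite -/(I F) -/(I F1) -/(I F2).
have IF : (c0%:E * I F <= (c0 * A * (2 * rho) ^+ 4)%:E)%E.
  rewrite -mulrA EFinM lee_wpmul2l ?lee_fin// EFinM.
  rewrite -(lebesgue4_hcube c rho0) -(integral_cst _ mQ A%:E).
  apply: ge0_le_integral => //.
  - by move=> p /F0/andP[? _]; rewrite lee_fin.
  - exact/measurable_EFinP.
  - by move=> p /F0/andP[_ ?]; rewrite lee_fin.
have I12 : ((B * (rho / 2) ^+ 4)%:E <= I F1 + I F2)%E.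
  rewrite /I -ge0_integralD//; last 4 first.
  - by move=> p /F120[? _]; rewrite lee_fin.
  - exact/measurable_EFinP.
  - by move=> p /F120[_ ?]; rewrite lee_fin.
  - exact/measurable_EFinP.
  have mF12 : measurable_fun (Q : set (mspacetime R)) (fun p => (F1 p)%:E + (F2 p)%:E)%E.
    by apply: emeasurable_funD; exact/measurable_EFinP.
  apply: (@le_trans _ _
    (\int[lebesgue4 R]_(p in box c (rho / 4)) ((F1 p)%:E + (F2 p)%:E))%E); last first.
    apply: ge0_subset_integral => // p /F120[? ?].
    by rewrite -EFinD lee_fin addr_ge0.
  have r4 : 0 < rho / 4 by lra.
  rewrite EFinM (_ : rho / 2 = 2 * (rho / 4)); last by lra.
  rewrite -(lebesgue4_box c r4) -(integral_cst _ mC B%:E).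
  by apply: ge0_le_integral => //; exact: measurable_funS mF12.
have [h1|h1] := leP (c0%:E * I F)%E (I F1); first by left.
right; rewrite leNgt; apply/negP => h2.
have := le_lt_trans I12 (lteD (lt_le_trans h1 IF) (lt_le_trans h2 IF)).
by rewrite -EFinD lte_fin; lra.
Qed.

Lemma solves_wave (R : realType) (n xi m : 'rV[R]_3) (h c : R) (psi : expr R) :
  dot n n = 1 -> dot xi xi = 1 -> dot n xi = 0 -> dot m n = 0 ->
  dot m xi = 0 ->
  solves (velocity n xi h psi) (stress n xi m h c psi).
Proof.
move=> nn xx nx mn mx; split => [i p|p|i j p|p].
- exact: div_stress.
- exact: div_velocity.
- exact: stressC.
- exact: trace_stress.
Qed.

Lemma trig_le1 (R : realType) (a : R) (l : nat) (x : R) : `|trig a l x| <= 1.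
Proof. exact: sin_max. Qed.

Lemma trig_sqrD (R : realType) (l : nat) (x : R) :
  trig 0 l x ^+ 2 + trig (pi / 2) l x ^+ 2 = 1.
Proof.
rewrite /= (_ : x + (pi / 2 + _) = x + (0 + l%:R * (pi / 2)) + pi / 2).
  by rewrite sinDpihalf addrC cos2Dsin2.
by ring.
Qed.

Lemma continuous_sqnorm (R : realType) (T : topologicalType)
    (f : T -> 'rV[R]_3) (x : T) :
  {for x, continuous f} -> {for x, continuous (fun t => sqnorm (f t))}.
Proof.
move=> cf; apply: continuous_sum3 => i.
have ci : {for x, continuous (fun t => f t 0 i)}.
  by apply: (@continuous_comp _ _ _ f (fun v : 'rV[R]_3 => v 0 i)) => //;
    exact: coord_continuous.
exact: (cvgM ci ci).
Qed.

Section local_construction.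
Variables (R : realType) (ebar : R) (U : set (spacetime R)).
Variables (g : spacetime R -> 'rV[R]_3) (W : spacetime R -> 'M[R]_3).
Variables (e r : spacetime R -> R).
Hypotheses (ebar_gt0 : 0 < ebar) (oU : open U).
Hypotheses (cg : forall p, U p -> {for p, continuous g}).
Hypotheses (cW : forall p, U p -> {for p, continuous W}).
Hypotheses (ce : forall p, U p -> {for p, continuous e}).
Hypotheses (cr : forall p, U p -> {for p, continuous r}).
Hypotheses (Wst : forall p, U p -> sym_traceless (W p)).
Hypotheses (r0 : forall p, U p -> 0 < r p).
Hypotheses (e_le : forall p, U p -> e p <= ebar).
Hypotheses (sub : forall p, U p ->
  3 / 2 * lambda_max ((r p)^-1 *: otimes (g p) (g p) - W p) < e p).

(** Chosen to meet the hypothesis of [energy_pick]. The product [144 * 16 = 64 * 36] gathers the two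
    phases, the bound [2 * gap p], the volume factor 16 of the cube and the 36 from the amplitude;
    128 gathers the 8 of the energy density and the volume factor 1/16 of the inner box. *)
Definition energy_const : R := expR (- 16) ^+ 2 / (128 * 144 * 16 * ebar).

Lemma energy_const_gt0 : 0 < energy_const.
Proof. by rewrite divr_gt0 ?mulr_gt0 ?exprn_gt0 ?expR_gt0. Qed.

Definition gap (p : spacetime R) : R :=
  (e p - 1 / 2 * (sqnorm (g p) / r p)) ^+ 2.

Definition energy (w : spacetime R -> 'rV[R]_3) (p : spacetime R) : R :=
  sqnorm (w p) / r p.

Lemma continuous_invr p : U p -> {for p, continuous (fun q => (r q)^-1)}.
Proof. by move=> Up; apply: cvgV (cr Up); rewrite gt_eqF ?r0. Qed.

Lemma continuous_energy w p : U p -> {for p, continuous w} ->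
  {for p, continuous (energy w)}.
Proof.
by move=> Up cw; exact: cvgM (continuous_sqnorm cw) (continuous_invr Up).
Qed.

Lemma continuous_gap p : U p -> {for p, continuous gap}.
Proof.
move=> Up; have c1 : {for p, continuous (fun p => e p - 1 / 2 * (sqnorm (g p) / r p))}.
  apply: (cvgB (ce Up)); apply: (cvgM (@cvg_cst _ _ _ _ _)).
  exact: continuous_energy (cg Up).
exact: (cvgM c1 c1).
Qed.

(** The supports lie in a closed box strictly inside the cube, so fields of different cells do not
    interact, and the energy bound compares integrals over the cube, hence adds up over cells. *)
Definition good_cube (c : spacetime R) (rho : R) : Prop :=
  exists (Ew : 'I_3 -> expr R) (EV : 'I_3 -> 'I_3 -> expr R),
  [/\ solves Ew EV,
      (forall i, vanishes_off (box c (rho / 2)) (Ew i)) /\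
      (forall i j, vanishes_off (box c (rho / 2)) (EV i j)),
      hcube c rho `<=` U,
      forall p, hcube c rho p -> 3 / 2 * lambda_max
        ((r p)^-1 *: otimes (g p + vfield Ew p) (g p + vfield Ew p) -
          (W p + eval_mx EV p)) < e p &
      (energy_const%:E * \int[lebesgue4 R]_(p in hcube c rho) (gap p)%:E <=
       \int[lebesgue4 R]_(p in hcube c rho) (energy (vfield Ew) p)%:E)%E].

Lemma continuous_near_le (f : spacetime R -> R) (p : spacetime R) (d : R) :
  0 < d -> {for p, continuous f} -> \forall q \near p, `|f q - f p| <= d.
Proof.
move=> d0 /cvgrPdist_le /(_ _ d0); apply: filterS => q.
by rewrite distrC.
Qed.

(** The data are frozen at [p], wherever it sits in the cube, so the grid need not be adapted to
    [p]. The size [eta] is fixed by continuity at [p]; the frequency is chosen after the cube,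
    because the derivatives of the cutoff depend on [rho]. *)
Lemma good_cube_near (p : spacetime R) : U p ->
  exists2 eta : R, 0 < eta & forall c rho, 0 < rho -> rho < eta ->
    hcube c rho p -> good_cube c rho.
Proof.
move=> Up.
have [gap0 [n [xi [m [h [kappa [[nn xx nx mn mx] k0 hE H]]]]]]] :=
  oscillation_direction ebar_gt0 (r0 Up) (e_le Up) (Wst Up) (sub Up).
have rp0 := r0 Up.
have gapp0 : 0 < gap p by rewrite exprn_gt0.
have h20 : 0 < h ^+ 2 / r p.
  by apply: lt_le_trans hE; rewrite divr_gt0// mulr_gt0.
have hn0 : 0 < `|h|.
  rewrite normr_gt0; apply: contraTneq h20 => ->.
  by rewrite expr0n mul0r ltxx.
have [d [Pd d0]] := filter_ex (filterI (perturbed_subsolution k0 H)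
  (nbhs_right_gt (0 : R))).
rewrite /= in d0.
pose c1 := expR (- 16) : R.
have c10 : 0 < c1 by exact: expR_gt0.
(* The bound by [d] preserves the strict inequality; the bound by [|h| * c1 / 8] makes the loss
   [6 * eps ^+ 2] over both phases smaller than a quarter of [h ^+ 2 * c1 ^+ 2]. *)
pose eps := Num.min d (`|h| * c1 / 8).
have eps0 : 0 < eps by rewrite lt_min d0 divr_gt0 ?mulr_gt0.
(* The last two tolerances are the values at [p] themselves, which are positive; they yield
   [r q <= 2 * r p] and [gap q <= 2 * gap p] on the cube. *)
have nA : \forall q \near p, [/\ U q, `|(r q)^-1 - (r p)^-1| <= d,
    `|e q - e p| <= d, (forall i, `|g q 0 i - g p 0 i| <= d) &
    (forall i j, `|W q i j - W p i j| <= d)] /\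
    `|r q - r p| <= r p /\ `|gap q - gap p| <= gap p.
  have cgi i : {for p, continuous (fun q => g q 0 i)}.
    apply: (@continuous_comp _ _ _ g (fun v : 'rV[R]_3 => v 0 i) p (cg Up)).
    exact: coord_continuous.
  have cWi i j : {for p, continuous (fun q => W q i j)}.
    apply: (@continuous_comp _ _ _ W (fun v : 'M[R]_3 => v i j) p (cW Up)).
    exact: coord_continuous.
  apply: filterI; last apply: filterI.
  - near=> q; split.
    + by near: q; exact: open_nbhs_nbhs.
    + by near: q; exact: (continuous_near_le d0 (continuous_invr Up)).
    + by near: q; exact: (continuous_near_le d0 (ce Up)).
    + near: q; apply: filter_forall => i.
      exact: (continuous_near_le d0 (cgi i)).
    + near: q; apply: filter_forall => i; apply: filter_forall => j.
      exact: (continuous_near_le d0 (cWi i j)).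
  - exact: (continuous_near_le rp0 (cr Up)).
  - exact: (continuous_near_le gapp0 (continuous_gap Up)).
have [eta eta0 etaA] := nbhs_hcube nA.
exists eta => // c rho rho0 rhoe cp.
have {etaA} QA q : hcube c rho q -> _ := etaA c rho rhoe cp q.
have rho2 : 0 < rho / 2 by lra.
pose K := box c (rho / 2); pose chi := bump c (rho / 2).
have cK : compact K by exact: compact_box.
have clK : closed K by exact: closed_box.
have chiK : vanishes_off K chi by exact: bump_vanishes_off.
pose phase (b : bool) : R := if b then pi / 2 else 0.
pose psi b k := plane_wave (trig (phase b)) chi (space_vec xi) k.
pose s b k q := eval chi q * trig (phase b) 3 (dot4 (k *: space_vec xi) q + 0).
have [k Pk] : exists k, forall (b : bool) (i j : 'I_3) q,
    `|eval (velocity n xi h (psi b k) i) q - s b k q * (h * n 0 i)| <= eps /\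
    `|eval (stress n xi m h (h / r p) (psi b k) i j) q -
      s b k q * (h / r p * (n 0 i * m 0 j + n 0 j * m 0 i))| <= eps.
  have F : \forall k \near +oo, forall (b : bool) (i j : 'I_3), (forall q,
    `|eval (velocity n xi h (psi b k) i) q - s b k q * (h * n 0 i)| <= eps) /\
    (forall q, `|eval (stress n xi m h (h / r p) (psi b k) i j) q -
      s b k q * (h / r p * (n 0 i * m 0 j + n 0 j * m 0 i))| <= eps).
    apply: filter_forall => b; apply: filter_forall => i.
    apply: filter_forall => j; apply: filterI.
      exact: (unif_close_velocity (@trig_le1 R (phase b)) cK clK chiK xx nx h i eps0).
    exact: (unif_close_stress (@trig_le1 R (phase b)) cK clK chiK xx nx mx
      h (h / r p) i j eps0).
  have [k Fk] := filter_ex F; exists k => b i j q.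
  by have [F1 F2] := Fk b i j; split.
have chi01 q : 0 <= eval chi q <= 1 by rewrite bump_ge0 bump_le1.
have s1 b q : `|s b k q| <= 1.
  rewrite normrM mulr_ile1 ?trig_le1//.
  by have /andP[x0 x1] := chi01 q; rewrite ger0_norm.
pose Ew b := velocity n xi h (psi b k).
pose EV b := stress n xi m h (h / r p) (psi b k).
have QU : hcube c rho `<=` U by move=> q /QA[[]].
have psiK b : vanishes_off K (psi b k).
  by apply: vanishes_offZ; exact: vanishes_offM.
have sol b : solves (Ew b) (EV b) by exact: solves_wave.
have ineq b q : hcube c rho q -> 3 / 2 * lambda_max
    ((r q)^-1 *: otimes (g q + vfield (Ew b) q) (g q + vfield (Ew b) q) -
      (W q + eval_mx (EV b) q)) < e q.
  move=> /QA[[Uq rq eq gq Wq] _]; apply: (Pd _ _ (s b k q)) => //.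
  - move=> i; rewrite mxE; have [+ _] := Pk b i i q.
    by move=> /le_trans; apply; rewrite ge_min lexx.
  - move=> i j; rewrite mxE; have [_ +] := Pk b i j q.
    by move=> /le_trans; apply; rewrite ge_min lexx.
  - by have [] := Wst Uq.
  - by apply/matrixP => i j; rewrite !mxE stressC.
pose E b := energy (vfield (Ew b)).
have cE b q : U q -> {for q, continuous (E b)}.
  move=> Uq; apply: continuous_energy => //.
  apply: continuous_mx => i j.
  rewrite (_ : (fun t => _) = eval (Ew b j)); first exact: continuous_eval.
  by apply/funext => t; rewrite mxE.
have E0 b q : hcube c rho q -> 0 <= E b q.
  by move=> /QU/r0 rq; rewrite divr_ge0 ?sqnormE ?dot_ge0// ltW.
have pick : exists b, (energy_const%:E *
    \int[lebesgue4 R]_(p in hcube c rho) (gap p)%:E <=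
    \int[lebesgue4 R]_(p in hcube c rho) (E b p)%:E)%E.
  suff : (energy_const%:E * \int[lebesgue4 R]_(p in hcube c rho) (gap p)%:E <=
    \int[lebesgue4 R]_(p in hcube c rho) (E false p)%:E)%E \/
   (energy_const%:E * \int[lebesgue4 R]_(p in hcube c rho) (gap p)%:E <=
    \int[lebesgue4 R]_(p in hcube c rho) (E true p)%:E)%E.
    by move=> []; [exists false|exists true].
  apply: (@energy_pick _ _ _ _ (2 * gap p) (h ^+ 2 * c1 ^+ 2 / (8 * r p))) => //.
  - exact/ltW/energy_const_gt0.
  - by rewrite mulr_ge0// ltW.
  - by rewrite divr_ge0 ?(mulr_ge0 (sqr_ge0 _) (sqr_ge0 _))// mulr_ge0 ?(ltW rp0).
  - move=> G GE; apply: (@measurable_funS _ _ _ _ U) => //.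
      exact: open_measurable4.
    apply: measurable_fun_open4 => // q Uq; move: GE; rewrite !inE.
    by move=> /or3P[] /eqP ->; [exact: continuous_gap|exact: cE..].
  - move=> q /QA[_ [_]]; rewrite ler_norml => /andP[_ ?].
    by rewrite sqr_ge0 /=; lra.
  - by move=> q Qq; split; exact: E0.
  - move=> q Cq.
    have Qq : hcube c rho q by apply: box_sub_hcube Cq; lra.
    have c1q : c1 <= eval chi q.
      apply: bump_ge => //; rewrite (_ : rho / 2 / 2 = rho / 4)//; lra.
    have rq0 := r0 (QU _ Qq).
    have rq : r q <= 2 * r p.
      by have [_ [+ _]] := QA _ Qq; rewrite ler_norml => /andP[_ ?]; lra.
    (* With [a = t h n_i], the square [(2 v - a)^2 >= 0] gives [v^2 >= a^2 / 2 - (v - a)^2]; the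
       three components are summed using [|n| = 1]. *)
    have low b : s b k q ^+ 2 * h ^+ 2 / 2 - 3 * eps ^+ 2 <=
        sqnorm (vfield (Ew b) q).
      have -> : s b k q ^+ 2 * h ^+ 2 / 2 - 3 * eps ^+ 2 =
          \sum_(i < 3) (s b k q ^+ 2 * h ^+ 2 / 2 * (n 0 i * n 0 i) - eps ^+ 2).
        by rewrite sumrB -mulr_sumr -/(dot n n) nn mulr1 sumr_const card_ord
          mulr_natl.
      apply: ler_sum => i _; rewrite mxE; have [+ _] := Pk b i i q.
      set v := eval _ q; set t := s b k q => vt.
      have : (v - t * (h * n 0 i)) ^+ 2 <= eps ^+ 2.
        by rewrite -(real_normK (num_real (v - _))) ler_sqr ?nnegrE// ltW.
      have := sqr_ge0 (2 * v - t * (h * n 0 i)).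
      move: (n 0 i) (eps ^+ 2) => y z; lra.
    have ss : c1 ^+ 2 <= s false k q ^+ 2 + s true k q ^+ 2.
      have -> : s false k q ^+ 2 + s true k q ^+ 2 = eval chi q ^+ 2.
        by rewrite /s !exprMn -mulrDr trig_sqrD mulr1.
      by apply: lerXn2r c1q; rewrite nnegrE; [exact: ltW|exact: bump_ge0].
    have eps2 : eps ^+ 2 <= h ^+ 2 * c1 ^+ 2 / 64.
      have -> : h ^+ 2 * c1 ^+ 2 / 64 = (`|h| * c1 / 8) ^+ 2.
        by rewrite -(real_normK (num_real h)); field.
      by rewrite ler_sqr ?nnegrE ?(ltW eps0) ?divr_ge0 ?mulr_ge0 ?(ltW c10)//
        ge_min lexx orbT.
    have tot : h ^+ 2 * c1 ^+ 2 / 4 <=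
        sqnorm (vfield (Ew false) q) + sqnorm (vfield (Ew true) q).
      have := low false; have := low true; have := ler_wpM2r (sqr_ge0 h) ss.
      have : 0 <= h ^+ 2 * c1 ^+ 2 by rewrite mulr_ge0 ?sqr_ge0.
      lra.
    rewrite /E /energy -mulrDl ler_pdivlMr//; apply: le_trans tot.
    rewrite mulrAC ler_pdivrMr ?mulr_gt0//.
    have := ler_wpM2l (_ : 0 <= h ^+ 2 * c1 ^+ 2) rq.
    by move=> /(_ (mulr_ge0 (sqr_ge0 _) (sqr_ge0 _))); lra.
  - have -> : 2 * (energy_const * (2 * gap p) * (2 * rho) ^+ 4) =
        gap p / (36 * ebar) * (c1 ^+ 2 * rho ^+ 4 / 128).
      by rewrite /energy_const -/c1; field; rewrite gt_eqF.
    have -> : h ^+ 2 * c1 ^+ 2 / (8 * r p) * (rho / 2) ^+ 4 =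
        h ^+ 2 / r p * (c1 ^+ 2 * rho ^+ 4 / 128).
      by field; rewrite gt_eqF.
    apply: ler_wpM2r hE.
    by rewrite divr_ge0 ?mulr_ge0 ?sqr_ge0 ?exprn_ge0// ltW.
have [b Eb] := pick; exists (Ew b), (EV b); split => //.
- split => [i|i j]; first exact: vanishes_off_velocity.
  exact: vanishes_off_stress.
- exact: ineq.
Unshelve. all: by end_near. Qed.

End local_construction.

(** * Gluing over a grid *)

Definition sum_expr (R : realType) (I : Type) (s : seq I) (f : I -> expr R) :
    expr R := \big[@Add R/Cst 0]_(z <- s) f z.

Lemma eval_sum_expr (R : realType) (I : Type) (s : seq I) (f : I -> expr R)
    (p : spacetime R) :
  eval (sum_expr s f) p = \sum_(z <- s) eval (f z) p.
Proof.
rewrite /sum_expr; elim: s => [|z s IH]; first by rewrite !big_nil.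
by rewrite !big_cons /= IH.
Qed.

Lemma dexpr_sum_expr (R : realType) (I : Type) (s : seq I) (f : I -> expr R)
    (v p : spacetime R) :
  eval (dexpr v (sum_expr s f)) p = \sum_(z <- s) eval (dexpr v (f z)) p.
Proof.
rewrite /sum_expr; elim: s => [|z s IH]; first by rewrite !big_nil.
by rewrite !big_cons /= IH.
Qed.

Lemma solves_sum (R : realType) (I : Type) (s : seq I)
    (Ew : I -> 'I_3 -> expr R) (EV : I -> 'I_3 -> 'I_3 -> expr R) :
  (forall z, solves (Ew z) (EV z)) ->
  solves (fun i => sum_expr s (Ew^~ i)) (fun i j => sum_expr s (fun z => EV z i j)).
Proof.
move=> sol; split => [i p|p|i j p|p].
- rewrite dexpr_sum_expr.
  under [X in _ + X]eq_bigr do rewrite dexpr_sum_expr.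
  rewrite exchange_big -big_split big1// => z _.
  by have [+ _ _ _] := sol z; exact.
- under eq_bigr do rewrite dexpr_sum_expr.
  rewrite exchange_big big1// => z _.
  by have [_ + _ _] := sol z; exact.
- rewrite !eval_sum_expr; apply: eq_bigr => z _.
  by have [_ _ + _] := sol z; exact.
- under eq_bigr do rewrite eval_sum_expr.
  rewrite exchange_big big1// => z _.
  by have [_ _ _] := sol z; exact.
Qed.

Lemma solves_pde (R : realType) (Ew : 'I_3 -> expr R)
    (EV : 'I_3 -> 'I_3 -> expr R) (p : spacetime R) :
  solves Ew EV ->
  partial_t (vfield Ew) p + div_mx (eval_mx EV) p = 0 /\
  div_vec (vfield Ew) p = 0.
Proof.
move=> [h1 h2 _ _]; split.
  rewrite /vfield partial_eval_mx; apply/rowP => i; rewrite !mxE -[RHS](h1 i p).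
  congr (_ + _); apply: eq_bigr => j _; rewrite -partial_eval.
  have -> // : (fun q => eval_mx EV q i j) = eval (EV i j).
  by apply/funext => q; rewrite mxE.
rewrite /div_vec -[RHS](h2 p); apply: eq_bigr => j _; rewrite -partial_eval.
have -> // : (fun q => vfield Ew q 0 j) = eval (Ew j).
by apply/funext => q; rewrite mxE.
Qed.

Lemma smooth_compact_support_eval_mx (R : realType) (m n : nat)
    (U C : set (spacetime R)) (E : 'I_m -> 'I_n -> expr R) :
  compact C -> C `<=` U -> (forall i j, vanishes_off C (E i j)) ->
  smooth_compact_support U (eval_mx E).
Proof.
move=> cC CU EC; have clC : closed C by exact: compact_closed.
have SC : closure [set p | eval_mx E p != 0] `<=` C.
  rewrite [X in _ `<=` X](closure_id C).1//; apply: closureS => p /=.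
  move=> /eqP E0; apply: contrapT => Cp; apply: E0.
  by apply/matrixP => i j; rewrite !mxE EC.
split; [exact: smooth_eval_mx| |exact: subset_trans SC CU].
by apply: subclosed_compact cC SC; exact: closed_closure.
Qed.

Lemma bounded_cell_index (R : realType) (U : set (spacetime R)) (rho : R) :
  0 < rho -> bounded_set U ->
  exists2 s : seq (int * int * int * int), uniq s &
    forall p, U p -> cell_index rho p \in s.
Proof.
move=> rho0 [M [_ MU]]; have {}MU p : U p -> `|p| <= M + 1.
  by apply: MU; rewrite ltrDl.
(* The extra unit absorbs the rounding of the floor: the quotients are at most [B - 1] in absolute
   value, so the indices lie in [-B, ..., B], the [2 B + 1] entries of [L]. *)
pose B := `|Num.ceil ((M + 1) / (2 * rho))|%N.+1.
pose L := [seq k%:Z - B%:Z | k <- iota 0 (B + B).+1].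
have LP (x : R) : `|x| <= M + 1 -> Num.floor (x / (2 * rho)) \in L.
  move=> xM; set z := Num.floor _.
  have xB : `|x / (2 * rho)| <= B%:R - 1.
    rewrite normrM normfV (gtr0_norm (_ : 0 < 2 * rho)) ?mulr_gt0//.
    apply: (@le_trans _ _ ((M + 1) / (2 * rho))).
      by rewrite ler_pM2r// invr_gt0 mulr_gt0.
    rewrite (le_trans (ceil_ge _))// /B -[X in _ <= X - 1]natr1 addrK [X in _ <= X]pmulrn.
    by rewrite ler_int lez_abs.
  have zlo : - B%:Z <= z.
    rewrite -(@ler_int R) mulrNz -lerN2 opprK.
    have := floorD1_gt (x / (2 * rho)); rewrite -/z intrD.
    by move: xB; rewrite ler_norml pmulrn => /andP[+ _]; lra.
  have zhi : z <= B%:Z.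
    rewrite -(@ler_int R); have := floor_le (x / (2 * rho)); rewrite -/z.
    by move: xB; rewrite ler_norml pmulrn => /andP[_ +]; lra.
  apply/mapP; exists `|(z + B%:Z)%R|%N; last by rewrite gez0_abs; lia.
  by rewrite mem_iota; lia.
pose s := [seq (x, d) | x <- [seq (y, c) | y <- [seq (a, b) | a <- L, b <- L],
  c <- L], d <- L].
exists (undup s) => [|p Up]; first exact: undup_uniq.
have pM := MU _ Up.
have p1 : `|p.1| <= M + 1 by apply: le_trans pM; rewrite prod_normE le_max lexx.
have p2 : `|p.1.1| <= M + 1 by apply: le_trans p1; rewrite prod_normE le_max lexx.
rewrite mem_undup /cell_index; apply: allpairs_f; last first.
  by apply: LP; apply: le_trans pM; rewrite prod_normE le_max lexx orbT.
apply: allpairs_f; last first.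
  by apply: LP; apply: le_trans p1; rewrite prod_normE le_max lexx orbT.
apply: allpairs_f; apply: LP; apply: le_trans p2; rewrite prod_normE le_max lexx//.
by rewrite orbT.
Qed.

Section grid.
Variables (R : realType) (ebar : R) (U : set (spacetime R)).
Variables (g : spacetime R -> 'rV[R]_3) (W : spacetime R -> 'M[R]_3).
Variables (e r : spacetime R -> R).
Hypotheses (ebar_gt0 : 0 < ebar) (oU : open U) (bU : bounded_set U).
Hypotheses (cg : forall p, U p -> {for p, continuous g}).
Hypotheses (ce : forall p, U p -> {for p, continuous e}).
Hypotheses (cr : forall p, U p -> {for p, continuous r}).
Hypotheses (r0 : forall p, U p -> 0 < r p).
Hypotheses (sub : forall p, U p ->
  3 / 2 * lambda_max ((r p)^-1 *: otimes (g p) (g p) - W p) < e p).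

Let good rho z := good_cube ebar U g W e r (cell_center rho z) rho.

Definition good_set (rho : R) : set (spacetime R) :=
  [set p | U p /\ good rho (cell_index rho p)].

(** At each point of [U] only the field of its own cell is present, so the inequality is checked
    cell by cell. The energy is summed over the good cells and is nonnegative on the rest of [U]. *)
Lemma grid_fields (rho : R) : 0 < rho ->
  measurable (good_set rho : set (mspacetime R)) /\
  exists Ew EV C,
  [/\ solves Ew EV, compact C /\ C `<=` U,
      (forall i, vanishes_off C (Ew i)) /\ (forall i j, vanishes_off C (EV i j)),
      forall p, U p -> 3 / 2 * lambda_max
        ((r p)^-1 *: otimes (g p + vfield Ew p) (g p + vfield Ew p) -
          (W p + eval_mx EV p)) < e p &
      (\int[lebesgue4 R]_(p in good_set rho)
         ((energy_const ebar)%:E * (gap g e r p)%:E) <=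
       \int[lebesgue4 R]_(p in U) (energy r (vfield Ew) p)%:E)%E].
Proof.
move=> rho0.
(* The third clause sets the fields to zero on cells that are not good. The sum over all listed
   cells is then supported in the good ones, which lie inside [U]. *)
have [z|f fP] := @choice _ (('I_3 -> expr R) * ('I_3 -> 'I_3 -> expr R))%type
  (fun z E => [/\ solves E.1 E.2,
      (forall i, vanishes_off (box (cell_center rho z) (rho / 2)) (E.1 i)) /\
      (forall i j, vanishes_off (box (cell_center rho z) (rho / 2)) (E.2 i j)),
      ~ good rho z -> (forall i p, eval (E.1 i) p = 0) /\
        (forall i j p, eval (E.2 i j) p = 0) &
      good rho z -> [/\ cell rho z `<=` U,
        forall p, cell rho z p -> 3 / 2 * lambda_max
          ((r p)^-1 *: otimes (g p + vfield E.1 p) (g p + vfield E.1 p) -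
          (W p + eval_mx E.2 p)) < e p &
        ((energy_const ebar)%:E *
            \int[lebesgue4 R]_(p in cell rho z) (gap g e r p)%:E <=
         \int[lebesgue4 R]_(p in cell rho z) (energy r (vfield E.1) p)%:E)%E]]).
  have [gz|ngz] := pselect (good rho z).
    have [Ew [EV [sol van QU ineq en]]] := gz.
    by exists (Ew, EV); split.
  exists (fun=> Cst 0, fun _ _ => Cst 0); split => //.
  by split => [i p|p|//|p]; rewrite /= ?big1 ?addr0.
have [s us sP] := bounded_cell_index rho0 bU.
pose Ew i := sum_expr s (fun z => (f z).1 i).
pose EV i j := sum_expr s (fun z => (f z).2 i j).
pose c := energy_const ebar.
have boxcell z : box (cell_center rho z) (rho / 2) `<=` cell rho z.
  by apply: box_sub_hcube; lra.
(* The supports sit in disjoint cells, so at [p] every term other than that of index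
   [cell_index rho p] vanishes. *)
have local (F : int * int * int * int -> expr R) p :
    (forall z, vanishes_off (box (cell_center rho z) (rho / 2)) (F z)) -> U p ->
    eval (sum_expr s F) p = eval (F (cell_index rho p)) p.
  move=> vF Up; rewrite eval_sum_expr (bigD1_seq (cell_index rho p)) ?sP//=.
  rewrite big1 ?addr0// => z zp; apply: vF => /boxcell/(cellP _ _ rho0) zE.
  by rewrite zE eqxx in zp.
have Ewp p : U p -> vfield Ew p = vfield (f (cell_index rho p)).1 p.
  move=> Up; apply/rowP => i; rewrite !mxE; apply: local => // z.
  by have [_ [+ _] _ _] := fP z; exact.
have EVp p : U p -> eval_mx EV p = eval_mx (f (cell_index rho p)).2 p.
  move=> Up; apply/matrixP => i j; rewrite !mxE; apply: local => // z.
  by have [_ [_ +] _ _] := fP z; exact.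
pose sg := [seq z <- s | `[< good rho z >]].
have sgP z : z \in sg -> good rho z.
  by rewrite mem_filter => /andP[/asboolP].
have usg : uniq sg by exact: filter_uniq.
have inc p : cell rho (cell_index rho p) p by exact/cellP.
have gsE : good_set rho = \big[setU/set0]_(z <- sg) cell rho z.
  rewrite -bigcup_seq; apply/seteqP; split => [p [Up gp]|p [z /= zs zp]].
    exists (cell_index rho p) => //=.
    by rewrite mem_filter sP// andbT; exact/asboolP.
  have gz := sgP _ zs; have [_ _ _ /(_ gz)[zU _ _]] := fP z.
  by split; [exact: zU|rewrite (cellP z p rho0).1].
have mcell z : measurable (cell rho z : set (mspacetime R)).
  exact: measurable_hcube.
have mgs : measurable (good_set rho : set (mspacetime R)).
  by rewrite gsE; exact: bigsetU_measurable.
split => //; exists Ew, EV.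
exists (\big[setU/set0]_(z <- sg) box (cell_center rho z) (rho / 2)); split.
- by apply: (@solves_sum _ _ s (fun z => (f z).1) (fun z => (f z).2)) => z;
    have [] := fP z.
- split; first by apply: bigsetU_compact => z _; exact: compact_box.
  rewrite -bigcup_seq => p [z /= /sgP gz /boxcell zp].
  by have [_ _ _ /(_ gz)[zU _ _]] := fP z; exact: zU.
- have van (F : int * int * int * int -> expr R) :
      (forall z, vanishes_off (box (cell_center rho z) (rho / 2)) (F z)) ->
      (forall z, ~ good rho z -> forall p, eval (F z) p = 0) ->
      vanishes_off (\big[setU/set0]_(z <- sg) box (cell_center rho z) (rho / 2))
        (sum_expr s F).
    move=> vF F0 p; rewrite -bigcup_seq => np; rewrite eval_sum_expr.
    rewrite big1_seq// => z /andP[_ zs].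
    have [gz|/F0//] := pselect (good rho z).
    apply: vF => zp; apply: np; exists z => //=.
    by rewrite mem_filter zs andbT; exact/asboolP.
  split => [i|i j]; apply: van => z.
  + by have [_ [+ _] _ _] := fP z; exact.
  + by move=> gz; have [_ _ /(_ gz)[+ _] _] := fP z; exact.
  + by have [_ [_ +] _ _] := fP z; exact.
  + by move=> gz; have [_ _ /(_ gz)[_ +] _] := fP z; exact.
- move=> p Up; rewrite Ewp// EVp//; set z := cell_index rho p.
  have [gz|ngz] := pselect (good rho z).
    by have [_ _ _ /(_ gz)[_ + _]] := fP z; apply; exact: inc.
  have [_ _ /(_ ngz)[w0 V0] _] := fP z.
  have -> : vfield (f z).1 p = 0 by apply/rowP => i; rewrite !mxE w0.
  have -> : eval_mx (f z).2 p = 0 by apply/matrixP => i j; rewrite !mxE V0.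
  by rewrite !addr0; exact: sub.
have gsU : good_set rho `<=` U by move=> p [].
have cEw p : U p -> {for p, continuous (energy r (vfield Ew))}.
  move=> Up; apply: (continuous_energy cr r0 Up).
  apply: continuous_mx => i j.
  rewrite (_ : (fun t => _) = eval (Ew j)); first exact: continuous_eval.
  by apply/funext => t; rewrite mxE.
have mU : measurable (U : set (mspacetime R)) by exact: open_measurable4.
have men : measurable_fun (U : set (mspacetime R)) (fun p => (energy r (vfield Ew) p)%:E).
  by apply/measurable_EFinP; exact: measurable_fun_open4.
have mgap : measurable_fun (U : set (mspacetime R)) (fun p => (gap g e r p)%:E).
  by apply/measurable_EFinP; apply: measurable_fun_open4 => // p;
    exact: (continuous_gap cg ce cr r0).
have en0 p : U p -> (0 <= (energy r (vfield Ew) p)%:E)%E.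
  by move=> /r0 rp; rewrite lee_fin divr_ge0 ?sqnormE ?dot_ge0// ltW.
apply: (@le_trans _ _
  (\int[lebesgue4 R]_(p in good_set rho) (energy r (vfield Ew) p)%:E)%E); last first.
  exact: ge0_subset_integral.
have triv : trivIset [set` sg] (cell rho).
  by move=> i j _ _ [p [/(cellP _ _ rho0) <- /(cellP _ _ rho0) <-]].
have c0 : 0 <= c by exact/ltW/energy_const_gt0.
rewrite gsE !ge0_integral_bigsetU//.
- rewrite !big_seq; apply: lee_sum => z /sgP gz.
  have [_ _ _ /(_ gz)[zU _ en]] := fP z.
  rewrite ge0_integralZl_EFin//; last 2 first.
  - by move=> p _; rewrite lee_fin sqr_ge0.
  - exact: measurable_funS mgap.
  apply: (le_trans en); rewrite le_eqVlt; apply/orP; left; apply/eqP.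
  apply: eq_integral => p; rewrite inE => zp.
  by rewrite /energy (Ewp _ (zU _ zp)) ((cellP z p rho0).1 zp).
- by rewrite -gsE; exact: measurable_funS men.
- by rewrite -gsE => p /gsU; exact: en0.
- by rewrite -gsE; apply: measurable_funeM; exact: measurable_funS mgap.
- by move=> p _; rewrite mule_ge0 ?lee_fin ?sqr_ge0.
Qed.

End grid.

(** * Passage to the limit as the mesh tends to zero *)

Lemma le_limn_einf (R : realType) (u v : nat -> \bar R) :
  (forall n, (u n <= v n)%E) -> (limn_einf u <= limn_einf v)%E.
Proof.
move=> uv; rewrite !limn_einf_lim; apply: lee_lim; do ?exact: is_cvg_einfs.
apply: nearW => n; apply: le_ereal_inf_tmp => _ [p /= np <-].
by apply: le_trans (uv p); apply: ereal_inf_lbound; exists p.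
Qed.

Theorem lemma3p1 (R : realType) (ebar : R) (ebar_gt0 : 0 < ebar) :
  exists2 c : R, 0 < c &
  forall (U : set (spacetime R))
         (g : spacetime R -> 'rV[R]_3) (W : spacetime R -> 'M[R]_3)
         (e r : spacetime R -> R),
    open U -> bounded_set U ->
    {within U, continuous g} -> {within U, continuous W} ->
    {within U, continuous e} -> {within U, continuous r} ->
    (forall p, U p -> sym_traceless (W p)) ->
    (forall p, U p -> 0 < r p) ->
    (forall p, U p -> e p <= ebar) ->
    (forall p, U p ->
      3 / 2 * lambda_max ((r p)^-1 *: otimes (g p) (g p) - W p) < e p) ->
  exists (w : nat -> spacetime R -> 'rV[R]_3)
         (V : nat -> spacetime R -> 'M[R]_3),
    [/\ forall n, smooth_compact_support U (w n),
        forall n, smooth_compact_support U (V n) /\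
                  (forall p, sym_traceless (V n p)),
        forall n p, partial_t (w n) p + div_mx (V n) p = 0 /\
                    div_vec (w n) p = 0,
        forall n p, U p ->
          3 / 2 * lambda_max
            ((r p)^-1 *: otimes (g p + w n p) (g p + w n p) - (W p + V n p))
          < e p &
        (c%:E * \int[lebesgue4 R]_(p in U)
                  ((e p - 1 / 2 * (sqnorm (g p) / r p)) ^+ 2)%:E
         <= limn_einf (fun n =>
              \int[lebesgue4 R]_(p in U) (sqnorm (w n p) / r p)%:E))%E ].
Proof.
exists (energy_const ebar); first exact: energy_const_gt0.
move=> U g W e r oU bU; rewrite !continuous_open_subspace// => cg cW ce cr.
move=> Wst r0 e_le sub.
have {}cg p : U p -> {for p, continuous g} by move=> Up; apply: cg; rewrite inE.
have {}cW p : U p -> {for p, continuous W} by move=> Up; apply: cW; rewrite inE.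
have {}ce p : U p -> {for p, continuous e} by move=> Up; apply: ce; rewrite inE.
have {}cr p : U p -> {for p, continuous r} by move=> Up; apply: cr; rewrite inE.
have grid n := grid_fields ebar_gt0 oU bU cg ce cr r0 sub (mesh_gt0 R n).
pose G n := good_set ebar U g W e r (mesh R n).
have mG n : measurable (G n : set (mspacetime R)) by have [] := grid n.
pose fld := (('I_3 -> expr R) * ('I_3 -> 'I_3 -> expr R) * set (spacetime R))%type.
have [n|f fP] := @choice nat fld (fun n F =>
  [/\ solves F.1.1 F.1.2, compact F.2 /\ F.2 `<=` U,
    (forall i, vanishes_off F.2 (F.1.1 i)) /\
    (forall i j, vanishes_off F.2 (F.1.2 i j)),
    forall p, U p -> 3 / 2 * lambda_max
      ((r p)^-1 *: otimes (g p + vfield F.1.1 p) (g p + vfield F.1.1 p) -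
        (W p + eval_mx F.1.2 p)) < e p &
    (\int[lebesgue4 R]_(p in G n)
        ((energy_const ebar)%:E * (gap g e r p)%:E) <=
      \int[lebesgue4 R]_(p in U) (energy r (vfield F.1.1) p)%:E)%E]).
  by have [_ [Ew [EV [C H]]]] := grid n; exists (Ew, EV, C).
exists (fun n => vfield (f n).1.1), (fun n => eval_mx (f n).1.2); split.
- move=> n; have [_ [cC CU] [vw _] _ _] := fP n.
  by apply: smooth_compact_support_eval_mx cC CU _ => i j; exact: vw.
- move=> n; have [[_ _ sV tV] [cC CU] [_ vV] _ _] := fP n; split.
    exact: smooth_compact_support_eval_mx cC CU vV.
  move=> p; split; first by apply/matrixP => i j; rewrite !mxE sV.
  by rewrite -[RHS](tV p); apply: eq_bigr => i _; rewrite mxE.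
- by move=> n p; have [sol _ _ _ _] := fP n; exact: solves_pde.
- by move=> n p Up; have [_ _ _ + _] := fP n; exact.
have mU : measurable (U : set (mspacetime R)) by exact: open_measurable4.
have mgap : measurable_fun (U : set (mspacetime R)) (fun p => (gap g e r p)%:E).
  by apply/measurable_EFinP; apply: measurable_fun_open4 => // p;
    exact: (continuous_gap cg ce cr r0).
have c0 : 0 <= energy_const ebar by exact/ltW/energy_const_gt0.
rewrite -ge0_integralZl_EFin//; last first.
  by move=> p _; rewrite lee_fin sqr_ge0.
pose h p := ((energy_const ebar)%:E * (gap g e r p)%:E)%E.
have h0 p : (0 <= h p)%E by rewrite mule_ge0 ?lee_fin ?sqr_ge0.
have mh : measurable_fun (U : set (mspacetime R)) h by exact: measurable_funeM.
pose u n : spacetime R -> \bar R := h \_ (G n).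
have GU n : G n `<=` U by move=> p [].
have mu_ n : measurable_fun (U : set (mspacetime R)) (u n).
  apply/measurable_restrict => //.
  by apply: measurable_funS mh => //; exact: subIsetl.
have u0 n p : U p -> (0 <= u n p)%E by move=> _; exact: erestrict_ge0.
(* For fixed [p] the value [u n p] equals [h p] as soon as the mesh is below the threshold at [p].
   This threshold is not uniform and the sets [G n] need not increase, hence the lower limit and
   Fatou's lemma. *)
have -> : (\int[lebesgue4 R]_(p in U) h p =
    \int[lebesgue4 R]_(p in U) limn_einf (u ^~ p))%E.
  apply: eq_integral => p; rewrite inE => Up.
  have [eta eta0 etaP] := good_cube_near ebar_gt0 oU cg cW ce cr Wst r0 e_le sub Up.
  have cvu : u n p @[n --> \oo] --> h p.
    apply: cvg_near_cst; apply: filterS (mesh_lt eta0) => n neta.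
    rewrite /u patchE ifT// inE; split => //.
    by apply: etaP => //; [exact: mesh_gt0|apply/cellP => //; exact: mesh_gt0].
  by have [-> _] := cvg_limn_einf_sup cvu.
apply: (le_trans (fatou (lebesgue4 R) mU mu_ u0)); apply: le_limn_einf => n.
rewrite /u -integral_mkcondr (setIidr (GU n)).
by have [_ _ _ _] := fP n.
Qed.
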